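(* Let $C$ be a curve contained in the double plane $2H\subset\mathbb{P}^3_k$, and let $T(C)=\{Z,Y,P\}$ be the associated triple. Then $Z\subseteq Y\subseteq P\subset H$, where $Z$ is a zero-dimensional subscheme which is a locally complete intersection in $H$, and $Y,P$ are curves in $H$. Moreover, if $g$ denotes the arithmetic genus of $C$, if $d,y,p$ denote the degrees of $C,Y,P$ respectively, and if $z$ denotes the length of $Z$, then $$d=y+p,\qquad g=\tfrac12(y-1)(y-2)+\tfrac12(p-1)(p-2)+y-z-1.$$
   Context: $k$ is an algebraically closed field. A curve is a purely one-dimensional locally Cohen-Macaulay (i.e. without embedded points) closed subscheme of $\mathbb{P}^3=\mathbb{P}^3_k$. $H\subset\mathbb{P}^3$ is a plane with equation $h=0$, and $2H$ is the scheme defined by $h^2=0$. The triple $T(C)=\{Z,Y,P\}$ associated to a curve $C\subset 2H$ is defined as follows. The scheme-theoretic intersection $C\cap H$ is a one-dimensional subscheme of $H$, possibly with embedded points, so one can write uniquely $\mathcal{I}_{C\cap H,H}=\mathcal{I}_{Z,H}(-P)$ with $P\subset H$ a curve (effective Cartier divisor of $H$) and $Z\subset H$ zero-dimensional (possibly empty); $P$ is the largest curve of $H$ contained in $C$ and $Z$ is the residual scheme of $P$ in $C\cap H$. $Y$ is the residual scheme to the intersection of $C$ with $H$, i.e. $\mathcal{I}_Y=(\mathcal{I}_C:\mathcal{I}_H)$; it is empty (with $y=0$) if and only if $C\subset H$. *)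

(* Defs.v *)
(* Closed subschemes of P^3 = Proj k[x_0,..,x_3] are
   represented by their saturated homogeneous ideals (a bijection), so that
   X is a subscheme of Y iff the ideal of Y is contained in the ideal of X, and
   the empty subscheme is the unit ideal.  Ideals are Prop-valued predicates
   since sums, products and saturations are not decidable. *)
From HB Require Import structures.
From mathcomp Require Import all_boot all_algebra.
From mathcomp Require Import mpoly.
From Stdlib Require Import ClassicalEpsilon.

Set Implicit Arguments.
Unset Strict Implicit.
Unset Printing Implicit Defensive.

Import GRing.Theory.
Local Open Scope ring_scope.

Section Defs.
Variable k : fieldType.
Notation S := {mpoly k[4]}.
Implicit Types (I J X Y Z C P p q : S -> Prop) (f g h : S).

Definition ideal I : Prop :=
  [/\ I 0, forall f g, I f -> I g -> I (f + g) & forall f g, I g -> I (f * g)].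

Definition homogeneous_ideal I : Prop :=
  ideal I /\ forall f d, I f -> I (pihomog mdeg d f).

Definition principal h : S -> Prop := fun f => exists g, f = g * h.

Definition ideal_add I J : S -> Prop :=
  fun f => exists a b, [/\ I a, J b & f = a + b].

Definition ideal_mul I J : S -> Prop :=
  fun f => exists s : seq (S * S),
    (forall x, x \in s -> I x.1 /\ J x.2) /\ f = \sum_(x <- s) x.1 * x.2.

Definition colon I J : S -> Prop := fun f => forall g, J g -> I (f * g).

Definition saturation I : S -> Prop :=
  fun f => exists N, forall m : 'X_{1..4}, mdeg m = N -> I ('X_[m] * f).

Definition closed_subscheme X : Prop :=
  homogeneous_ideal X /\ forall f, saturation X f -> X f.

(* X is a subscheme of Y. *)
Definition subscheme X Y : Prop := forall f, Y f -> X f.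

Definition same_scheme X Y : Prop := forall f, X f <-> Y f.

Definition empty_scheme X : Prop := X 1.

Definition scheme_cap X Y : S -> Prop := saturation (ideal_add X Y).

(* Scheme-theoretic points of P^3: the homogeneous primes not containing the
   irrelevant ideal. *)
Definition point p : Prop :=
  [/\ homogeneous_ideal p, ~ p 1,
      forall f g, p (f * g) -> p f \/ p g &
      exists i : 'I_4, ~ p 'X_i].

Definition point_of X p : Prop := point p /\ subscheme p X.

(* A chain of r + 1 irreducible closed subsets of X, ordered decreasingly. *)
Definition has_chain X (r : nat) : Prop :=
  exists c : nat -> S -> Prop,
    (forall i, (i <= r)%N -> point_of X (c i)) /\
    (forall i, (i < r)%N ->
       subscheme (c i.+1) (c i) /\ ~ subscheme (c i) (c i.+1)).

Definition dimension X (r : nat) : Prop := has_chain X r /\ ~ has_chain X r.+1.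

(* The generic point of an irreducible component of X. *)
Definition generic_point X p : Prop :=
  point_of X p /\ forall q, point_of X q -> subscheme p q -> subscheme q p.

(* p is the annihilator of the class of f in S / X. *)
Definition associated_point X p : Prop :=
  point p /\ exists f, forall g, p g <-> X (g * f).

(* For a one-dimensional scheme, locally Cohen-Macaulay means that there are no
   embedded points.  In [dimension p 1], the prime p stands for the integral
   closed subscheme it defines, i.e. the component of X with its reduced
   structure. *)
Definition curve X : Prop :=
  [/\ closed_subscheme X, ~ empty_scheme X,
      forall p, generic_point X p -> dimension p 1 &
      forall p, associated_point X p -> generic_point X p].

(* Zero-dimensional or empty. *)
Definition zero_dimensional X : Prop := closed_subscheme X /\ ~ has_chain X 1.

(* V is a subspace of S, and V / (V :&: I) has k-dimension m. *)
Definition quotient_dim (V I : S -> Prop) (m : nat) : Prop :=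
  exists b : 'I_m -> S,
    [/\ forall i, V (b i),
        forall c : 'I_m -> k, I (\sum_i c i *: b i) -> forall i, c i = 0 &
        forall f, V f -> exists c : 'I_m -> k, I (f - \sum_i c i *: b i)].

Definition is_hilbert_poly X (Q : {poly rat}) : Prop :=
  exists N : nat, forall d : nat, (N <= d)%N ->
    exists m : nat,
      quotient_dim (fun f => f \is d.-homog) X m /\ Q.[d%:R] = m%:R.

Definition hilbert_poly X : {poly rat} :=
  epsilon (inhabits 0) (is_hilbert_poly X).

(* r! times the leading coefficient, r being the degree of the Hilbert
   polynomial; this is 0 for the empty scheme. *)
Definition degree X : rat :=
  ((size (hilbert_poly X)).-1)`!%:R * lead_coef (hilbert_poly X).

(* The case r = 1 of (-1)^r (Q(0) - 1). *)
Definition curve_genus X : rat := 1 - (hilbert_poly X).[0].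

(* If the linear form l vanishes at no point of Z, then Z is affine with
   coordinate ring (S_l / Z S_l)_0 = S / (Z + (l - 1)), and the length of Z is
   the k-dimension of this ring (k is algebraically closed). *)
Definition is_length Z (m : nat) : Prop :=
  exists l : S,
    [/\ l \is 1.-homog, forall p, point_of Z p -> ~ p l &
        quotient_dim (fun=> True) (ideal_add Z (principal (l - 1))) m].

Definition scheme_length Z : nat := epsilon (inhabits 0%N) (is_length Z).

(* At each point p of Z, the ideal of Z in the local ring of the plane h = 0 at
   p is generated by codim(Z) = 2 elements; denominators s have been cleared. *)
Definition lci_in_plane h Z : Prop :=
  forall p, point_of Z p ->
    exists (d e : nat) (a b : S),
      [/\ a \is d.-homog, b \is e.-homog, Z a, Z b &
          forall f, Z f -> exists (r : nat) (s u v w : S),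
            [/\ s \is r.-homog, ~ p s & s * f = u * a + v * b + w * h]].

(* The triple {Z, Y, P} of C.  With H the plane h = 0, the third clause is
   I_{C cap H, H} = I_{Z,H}(-P): as P is a Cartier divisor of H, the right-hand
   side is I_{Z,H} I_{P,H}, and both sides are lifted from S / (h) to S. *)
Definition associated_triple h C Z Y P : Prop :=
  [/\ curve P /\ subscheme P (principal h),
      zero_dimensional Z /\ subscheme Z (principal h),
      same_scheme (scheme_cap C (principal h))
                  (saturation (ideal_add (ideal_mul Z P) (principal h))) &
      same_scheme Y (colon C (principal h))].

End Defs.

(* Main.v *)
(* The ring S / (h) is factorial, so the unmixed ideals of the plane curves P and Y
   are principal: P = (h, f) and Y = (h, e).  Hence the ideal of the intersection of
   C with the plane is f Z + (h), and the inclusions between Z, Y and P can be checked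
   at the generic points of C, since C has no embedded points and Z misses its
   generic points.  Degree and genus follow by adding Hilbert functions along
   0 -> (S / Y)(-1) -> S / C -> S / (C + (h)) -> 0 and
   0 -> (S / Z)(-p) -> S / (f Z + (h)) -> S / (h, f) -> 0.

   For the local structure of Z, note that C / (h ^+ 2) is a submodule of the free
   S / (h)-module S / (h ^+ 2) of rank 2.  At a point of Z choose a linear form x that is
   a nonzerodivisor modulo C: modulo x we get a submodule of a free module of rank 2
   over a discrete valuation ring, so by Nakayama C / (h ^+ 2) is locally generated by
   two elements; dividing their images in S / (h) by f gives local generators of Z. *)
Require Import Defs.
From HB Require Import structures.
From mathcomp Require Import all_boot all_algebra.
From mathcomp Require Import ring zify.
From mathcomp Require Import mpoly.
From Stdlib Require Import Classical ClassicalEpsilon.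
From Stdlib Require Import FunctionalExtensionality PropExtensionality.
Set Implicit Arguments.
Unset Strict Implicit.
Unset Printing Implicit Defensive.
Import GRing.Theory Num.Theory.
Local Open Scope ring_scope.

(** * Noetherian rings and unique factorization *)

(** The inclusions rest on one relation: at a generic point [q] of C, where Z is empty,
    [s * f - c * h] lies in C for some [s] outside [q]. Multiplying it by [h] and using [h * h] in C
    gives that P contains Y; multiplying it by an element of (C : h), and later cancelling [f]
    modulo [h], gives that Y contains Z. Two obstacles shape the rest. The points of Z and the
    components of C are not known to be finite in number, so a linear form avoiding them is sought
    in a one-parameter family: if infinitely many parameters failed, Noetherian induction would
    produce a single point containing infinitely many members, and a Vandermonde determinant would
    put all coefficients of the family into it. And dimension is defined by chains of primes only;
    it is controlled by Hilbert functions, since a point with bounded Hilbert function admits no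
    chain of length 1. Local rings are replaced throughout by multipliers [s] outside a prime
    [p]. *)

Definition is_ideal (R : comNzRingType) (I : R -> Prop) : Prop :=
  [/\ I 0, forall f g, I f -> I g -> I (f + g) & forall f g, I g -> I (f * g)].

(** Generation by [s] is expressed by testing against every ideal [J] that contains [s], so that no
    linear combination has to be written out. *)
Definition noetherian (R : comNzRingType) : Prop :=
  forall I : R -> Prop, is_ideal I ->
  exists s : seq R, (forall x, x \in s -> I x) /\
    forall J : R -> Prop, is_ideal J -> (forall x, x \in s -> J x) ->
    forall f, I f -> J f.

Lemma noetherian_field (F : fieldType) : noetherian F.
Proof.
move=> I [I0 _ IM]; case: (classic (exists x, x != 0 /\ I x)) => [[x [x0 Ix]]|nI].
  exists [:: x]; split=> [y|J [_ _ JM] Jx f _]; first by rewrite inE => /eqP->.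
  by rewrite -(mulfVK x0 f); apply: JM; apply: Jx; rewrite inE.
exists [::]; split=> // J [J0 _ _] _ f If; suff -> : f = 0 by [].
by apply/eqP; apply/negPn/negP => f0; apply: nI; exists f.
Qed.

Lemma noetherian_image (R T : comNzRingType) (phi : {rmorphism R -> T}) :
  (forall y, exists x, phi x = y) -> noetherian R -> noetherian T.
Proof.
move=> phi_surj nR I [I0 ID IM].
have [|s [sI sJ]] := nR (fun x => I (phi x)).
  split=> [|f g|f g]; rewrite ?rmorph0 ?rmorphD ?rmorphM //.
    exact: ID.
  exact: IM.
exists (map phi s); split=> [y /mapP[x xs ->]|J [J0 JD JM] Js f]; first exact: sI.
have [x <-] := phi_surj f; apply: (sJ (fun x => J (phi x))) => [|y ys].
  split=> [|a b|a b]; rewrite ?rmorph0 ?rmorphD ?rmorphM //.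
    exact: JD.
  exact: JM.
by apply: Js; apply: map_f.
Qed.

(** * Hilbert's basis theorem *)

Section HilbertBasis.
Variable R : comNzRingType.
Implicit Types I J : {poly R} -> Prop.

(** Polynomials of smaller size are allowed and contribute 0; this makes each level an ideal and,
    through multiplication by powers of ['X], the levels increasing in [n]. *)
Definition lead_coefs I (n : nat) (a : R) : Prop :=
  exists f, [/\ I f, (size f <= n.+1)%N & f`_n = a].

Lemma lead_coefs_ideal I n : is_ideal I -> is_ideal (lead_coefs I n).
Proof.
move=> [I0 ID IM]; split.
- by exists 0; rewrite size_poly0 coef0.
- move=> a b [f [If sf <-]] [g [Ig sg <-]]; exists (f + g); rewrite coefD; split=> //.
    exact: ID.
  by rewrite (leq_trans (size_polyD _ _)) // geq_max sf sg.
- move=> a b [g [Ig sg <-]]; exists (a%:P * g); rewrite coefCM; split=> //.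
    exact: IM.
  by rewrite mul_polyC (leq_trans (size_scale_leq _ _)).
Qed.

Lemma lead_coefs_le I m n a : is_ideal I -> (m <= n)%N ->
  lead_coefs I m a -> lead_coefs I n a.
Proof.
move=> [I0 ID IM] mn [f [If sf <-]]; exists ('X^(n - m) * f); split.
- exact: IM.
- rewrite (leq_trans (size_polyMleq _ _)) // size_polyXn addSn /=.
  by rewrite -[X in (_ <= X.+1)%N](subnK mn) -addnS leq_add2l.
- by rewrite coefXnM ltnNge leq_subr /= subKn.
Qed.

Lemma lead_coefs_gens I n : noetherian R -> is_ideal I ->
  exists G : seq {poly R}, (forall x, x \in G -> I x) /\
  forall J, is_ideal J -> (forall x, x \in G -> J x) ->
  forall a, lead_coefs I n a -> lead_coefs (fun f => I f /\ J f) n a.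
Proof.
move=> nR Iid; have [s [sI sJ]] := nR _ (lead_coefs_ideal n Iid).
have [G [GI Gs]] : exists G : seq {poly R}, (forall x, x \in G -> I x) /\
    forall a, a \in s -> exists f, [/\ f \in G, (size f <= n.+1)%N & f`_n = a].
  elim: s sI {sJ} => [|a s IH] sI; first by exists [::].
  have [b bs|G [GI Gs]] := IH; first by apply: sI; rewrite inE bs orbT.
  have [|f [If sf fa]] := sI a; first by rewrite inE eqxx.
  exists (f :: G); split=> [x|b]; rewrite inE => /orP[/eqP->|] //; first exact: GI.
    by exists f; rewrite inE eqxx.
  by move=> /Gs[g [gG sg gb]]; exists g; rewrite inE gG orbT.
exists G; split=> // J Jid GJ; apply: sJ => [|a /Gs[f [fG sf fa]]].
  apply: lead_coefs_ideal; case: Iid Jid => [I0 ID IM] [J0 JD JM].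
  by split=> // [f g [? ?] [? ?]|f g [? ?]]; split; auto.
by exists f; split=> //; split; auto.
Qed.

(** The ideals of leading coefficients increase with the degree, so a single degree [N] carries
    generators of their union. Generators for the degrees up to [N] then suffice: [step] finds an
    element of [J] with the prescribed top coefficient, and subtracting it lowers the size. *)
Lemma noetherian_poly : noetherian R -> noetherian {poly R}.
Proof.
move=> nR I Iid; have [I0 ID IM] := Iid.
have [|s [sU Us]] := nR (fun a => exists n, lead_coefs I n a).
  split=> [|a b [m La] [n Lb]|a b [n Lb]].
  - by exists 0%N; have [] := lead_coefs_ideal 0 Iid.
  - exists (maxn m n); have [_ LD _] := lead_coefs_ideal (maxn m n) Iid.
    apply: LD; first exact: lead_coefs_le (leq_maxl _ _) La.
    exact: lead_coefs_le (leq_maxr _ _) Lb.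
  - by exists n; have [_ _ LM] := lead_coefs_ideal n Iid; apply: LM.
have [N sN] : exists N, forall a, a \in s -> lead_coefs I N a.
  elim: s sU {Us} => [|a s IH] sU; first by exists 0%N.
  have [b bs|N sN] := IH; first by apply: sU; rewrite inE bs orbT.
  have [|n La] := sU a; first by rewrite inE eqxx.
  exists (maxn N n) => b; rewrite inE => /orP[/eqP->|/sN Lb].
    exact: lead_coefs_le (leq_maxr _ _) La.
  exact: lead_coefs_le (leq_maxl _ _) Lb.
have [G [GI GJ]] : exists G : seq {poly R}, (forall x, x \in G -> I x) /\
    forall J, is_ideal J -> (forall x, x \in G -> J x) ->
    forall n a, (n <= N)%N -> lead_coefs I n a -> lead_coefs (fun f => I f /\ J f) n a.
  elim: N {sN} => [|N [G [GI GJ]]].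
    have [G [GI GJ]] := lead_coefs_gens 0 nR Iid; exists G; split=> // J Jid JG n a.
    by rewrite leqn0 => /eqP->; apply: GJ.
  have [G' [GI' GJ']] := lead_coefs_gens N.+1 nR Iid.
  exists (G' ++ G); split=> [x|J Jid JG n a]; first by rewrite mem_cat => /orP[/GI'|/GI].
  rewrite leq_eqVlt => /orP[/eqP->|nN].
    by apply: GJ' => // x xG; apply: JG; rewrite mem_cat xG.
  by apply: GJ => // x xG; apply: JG; rewrite mem_cat xG orbT.
exists G; split=> // J Jid JG.
have step n a : lead_coefs I n a -> lead_coefs (fun f => I f /\ J f) n a.
  move=> La; case: (leqP n N) => [nN|/ltnW nN]; first exact: GJ.
  apply: (@lead_coefs_le _ N) => //.
    by case: Jid => [J0 JD JM]; split=> // [f g [? ?] [? ?]|f g [? ?]]; split; auto.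
  by apply: GJ => //; apply: (Us _ (lead_coefs_ideal N Iid) sN); exists n.
move=> f; move: {2}(size f) (leqnn (size f)) => n; elim: n f => [|n IH] f sf If.
  by move: sf; rewrite leqn0 size_poly_eq0 => /eqP->; case: Jid.
have [|g [[Ig Jg] sg gf]] := step n f`_n; first by exists f.
have [_ JD _] := Jid; rewrite -(subrK g f); apply: (JD _ _ _ Jg); apply: IH.
  apply/leq_sizeP => j; rewrite leq_eqVlt => /orP[/eqP<-|nj].
    by rewrite coefB gf subrr.
  by rewrite coefB !nth_default ?subrr // (leq_trans _ nj).
by apply: ID => //; rewrite -mulN1r; apply: IM.
Qed.

End HilbertBasis.

(** * Prime elements, Gauss's lemma and factorial polynomial rings *)

Section Factorization.
Variable R : idomainType.
Implicit Types a b c p : R.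

Definition divides a b := exists c, b = c * a.

Lemma divides1 a : divides a 1 -> a \is a GRing.unit.
Proof. by move=> [c E]; apply/unitrP; exists c; rewrite [a * c]mulrC -E. Qed.

Definition prime_elt p : Prop :=
  [/\ p != 0, p \isn't a GRing.unit &
      forall a b, divides p (a * b) -> divides p a \/ divides p b].

(** The factors are required to be prime rather than irreducible: primality is what is used later,
    and uniqueness of the factorization is then automatic. *)
Definition factorizable a : Prop :=
  exists u (s : seq R), [/\ u \is a GRing.unit, forall p, p \in s -> prime_elt p &
    a = u * \prod_(p <- s) p].

Lemma factorizable_unit a : a \is a GRing.unit -> factorizable a.
Proof. by move=> ua; exists a, [::]; rewrite big_nil mulr1. Qed.

Lemma factorizableM a b : factorizable a -> factorizable b -> factorizable (a * b).
Proof.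
move=> [u [s [uu sp ->]]] [v [t [uv tp ->]]]; exists (u * v), (s ++ t); split.
- by rewrite unitrM uu.
- by move=> p; rewrite mem_cat => /orP[/sp|/tp].
- by rewrite big_cat /= mulrACA.
Qed.

Lemma factorizable_prime p : prime_elt p -> factorizable p.
Proof.
move=> pp; exists 1, [:: p]; split; rewrite ?unitr1 ?big_seq1 ?mul1r //.
by move=> q; rewrite inE => /eqP->.
Qed.

End Factorization.

Definition ufd (R : idomainType) := forall a : R, a != 0 -> factorizable a.

Lemma ufd_field (F : fieldType) : ufd F.
Proof. by move=> a a0; apply: factorizable_unit; rewrite unitfE. Qed.

Section GaussLemma.
Variable R : idomainType.
Implicit Types (c : R) (f g : {poly R}).

Lemma polyC_dividesP c f : divides c%:P f <-> forall i, divides c f`_i.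
Proof.
split=> [[g -> i]|H]; first by exists g`_i; rewrite coefMC.
elim/poly_ind: f H => [|f a IH] H; first by exists 0; rewrite mul0r.
have [|g gE] := IH.
  by move=> i; have := H i.+1; rewrite coefD coefMX coefC addr0.
have [b] := H 0%N; rewrite coefD coefMX coefC add0r => aE.
by exists (g * 'X + b%:P); rewrite mulrDl mulrAC -gE aE polyCM.
Qed.

(** Reduction modulo [c] without a quotient ring: [c] divides the product of the constant
    coefficients, hence one of them, and that factor can be replaced by its part above degree 0,
    which lowers the total size. *)
Lemma prime_polyC c : prime_elt c -> prime_elt c%:P.
Proof.
move=> [c0 cu cp]; split; first by rewrite polyC_eq0.
  by rewrite poly_unitE coefC eqxx negb_and cu orbT.
move=> f g; move: {2}(size f + size g)%N (leqnn (size f + size g)) => n.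
elim: n f g => [|n IH] f g.
  by rewrite leqn0 addn_eq0 size_poly_eq0 => /andP[/eqP->]; left; exists 0; rewrite mul0r.
case/boolP: (f == 0) => [/eqP->|f0]; first by left; exists 0; rewrite mul0r.
case/boolP: (g == 0) => [/eqP->|g0]; first by right; exists 0; rewrite mul0r.
have half (p q : {poly R}) : p != 0 -> (size p + size q <= n.+1)%N ->
    divides c%:P (p * q) -> divides c p`_0 -> divides c%:P p \/ divides c%:P q.
  elim/poly_ind: p => [|p a _]; first by rewrite eqxx.
  rewrite coefD coefMX coefC add0r /= => p0 sz [r rE] [a' aE].
  have szp : (size p + size q <= n)%N.
    move: p0 sz; rewrite size_MXaddC; case: ifP => [/andP[/eqP-> /eqP->]|_ _].
      by rewrite mul0r add0r eqxx.
    by rewrite addSn.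
  have [|[p' pE]|] := IH p q szp; last by right.
  - apply/polyC_dividesP => i; have/polyC_dividesP/(_ i.+1) :
        divides c%:P (p * q * 'X).
      exists (r - a'%:P * q); rewrite mulrBl -rE mulrDl.
      by rewrite aE polyCM mulrAC [_%:P * q * _]mulrAC addrK.
    by rewrite coefMX.
  - by left; exists (p' * 'X + a'%:P); rewrite mulrDl mulrAC -pE aE polyCM.
move=> sz H; have/polyC_dividesP/(_ 0%N) := H; rewrite coef0M => /cp[|] H0.
  exact: (half f g).
have [] := half g f g0 _ _ H0; rewrite 1?addnC 1?mulrC; by [|right|left].
Qed.

Definition primitive f := forall c, prime_elt c -> ~ divides c%:P f.

Lemma primitive_divisor f g : primitive f -> divides g f -> primitive g.
Proof. by move=> fp [r fE] c /fp H [g' gE]; apply: H; exists (r * g'); rewrite fE gE mulrA. Qed.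

(* [q %| f] over an integral domain is pseudo-divisibility, i.e. divisibility over
   the fraction field. *)
Lemma primitive_dvdp f g : ufd R -> primitive f -> f %| g -> divides f g.
Proof.
move=> uR fp /Pdiv.Idomain.dvdpP[[c r] /= c0].
have [u [s [uu sp ->]]] := uR c c0; elim: s g r sp => [|d s IH] g r sp.
  rewrite big_nil mulr1 => E; exists (u^-1 *: r).
  by rewrite -scalerAl -E scalerA mulVr ?scale1r.
rewrite big_cons mulrCA -scalerA => E.
have dp : prime_elt d by apply: sp; rewrite inE eqxx.
have [d0 _ _] := dp; have [_ _ dP] := prime_polyC dp.
have [|[r' rE]|] := dP r f.
- by exists ((u * \prod_(j <- s) j) *: g); rewrite -E [RHS]mulrC mul_polyC.
- apply: (IH _ r') => [p ps|]; first by apply: sp; rewrite inE ps orbT.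
  apply: (mulfI (_ : d%:P != 0)); first by rewrite polyC_eq0.
  by rewrite mul_polyC E rE mulrAC mulrC.
- by move/(fp d dp).
Qed.

Lemma prime_associated (c p : R) : prime_elt c -> prime_elt p ->
  divides c p -> exists2 u, u \is a GRing.unit & p = u * c.
Proof.
move=> [c0 cu _] [p0 pu pp] [u pE]; exists u => //.
have [|[v uE]|[v cE]] := pp u c; first by exists 1; rewrite mul1r pE.
  case/negP: cu; apply/unitrP; exists v; rewrite mulrC.
  have E : c * v * p = 1 * p by rewrite mul1r -mulrA -uE mulrC -pE.
  by have cv := mulIf p0 E; rewrite cv.
apply/unitrP; exists v; rewrite [u * v]mulrC.
have E : v * u * c = 1 * c by rewrite mul1r -mulrA -pE.
by have vu := mulIf c0 E; rewrite vu.
Qed.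

(** Dividing out a prime constant removes one prime factor from the leading coefficient, so the
    number of these factors bounds the process. *)
Lemma content_decomposition f : ufd R -> f != 0 ->
  exists c g, [/\ f = c%:P * g, c != 0, factorizable c%:P & primitive g].
Proof.
move=> uR f0; have [|u [s [uu sp]]] := uR (lead_coef f); first by rewrite lead_coef_eq0.
move: {2}(size s) (erefl (size s)) => n; elim: n s u f f0 uu sp => [|n IH] s u f f0 uu sp sz fE.
  exists 1, f; rewrite mul1r oner_eq0; split=> //.
    by apply: factorizable_unit; rewrite unitr1.
  move=> c [c0 cu cp] [g gE]; case/negP: cu.
  move: fE; rewrite (size0nil sz) big_nil mulr1 gE lead_coefM lead_coefC => E.
  by move: uu; rewrite -E unitrM => /andP[].
case: (classic (exists c, prime_elt c /\ divides c%:P f)) => [[c [cp [g gE]]]|nex].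
  2: { exists 1, f; rewrite mul1r oner_eq0; split=> //.
         by apply: factorizable_unit; rewrite unitr1.
       by move=> c cp cf; case: nex; exists c. }
have [c0 cu cpr] := cp.
have cs : divides c (u * \prod_(p <- s) p).
  by exists (lead_coef g); rewrite -fE gE lead_coefM lead_coefC.
have [p ps [v uv pE]] : exists2 p, p \in s & exists2 v, v \is a GRing.unit & p = v * c.
  have [[w uE]|] := cpr _ _ cs.
    by case/negP: cu; move: uu; rewrite uE unitrM => /andP[].
  elim: {fE sz cs} s sp => [|q s IHs] sp.
    rewrite big_nil => -[w wE]; case/negP: cu.
    by apply/unitrP; exists w; rewrite [c * w]mulrC -wE.
  rewrite big_cons => /cpr[cq|cs].
    have qp : prime_elt q by apply: sp; rewrite inE eqxx.
    by have := prime_associated cp qp cq; exists q; rewrite ?inE ?eqxx.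
  have [q' q's|p ps H] := IHs _ cs; first by apply: sp; rewrite inE q's orbT.
  by exists p; rewrite // inE ps orbT.
have [|||||d [g' [gE' d0 df g'p]]] := IH (rem p s) (u * v) g.
- by apply: contraNneq f0 => g0; rewrite gE g0 mul0r.
- by rewrite unitrM uu.
- by move=> q /mem_rem/sp.
- by rewrite size_rem // sz.
- apply: (mulIf c0); rewrite -{1}(lead_coefC c) -lead_coefM -gE fE.
  by rewrite (perm_big _ (perm_to_rem ps)) big_cons /= pE; ring.
exists (c * d), g'; split=> //.
- by rewrite gE gE' polyCM; ring.
- by rewrite mulf_neq0.
- by rewrite polyCM; apply: factorizableM => //; apply: factorizable_prime; apply: prime_polyC.
Qed.

(** A divisor [q] over the fraction field loses its content and then divides [f] over [R], so
    irreducibility leaves it constant or associated to [f]. Primality follows by applying this to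
    the gcd of [f] and [a], as in Euclid's lemma. *)
Lemma primitive_irreducible_prime f : ufd R -> primitive f -> (1 < size f)%N ->
  (forall g r, f = g * r -> size g = 1%N \/ size r = 1%N) -> prime_elt f.
Proof.
move=> uR fp sf firr; have f0 : f != 0 by rewrite -size_poly_gt0 ltnW.
split=> //; first by rewrite poly_unitE; case: eqP => // E; rewrite E in sf.
have irr (q : {poly R}) : q %| f -> size q = 1%N \/ q %= f.
  move=> qf; have q0 : q != 0.
    by apply: contraTneq qf => ->; rewrite dvd0p.
  have [c [q' [qE c0 _ q'p]]] := content_decomposition uR q0.
  have eqq : q %= q' by rewrite qE mul_polyC eqp_scale.
  have [|r fE] := primitive_dvdp uR q'p (_ : q' %| f).
    by rewrite -(eqp_dvdl _ eqq).
  have [sr|sq] := firr _ _ fE; last by left; rewrite (eqp_size eqq).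
  right; apply: (eqp_trans eqq); rewrite fE.
  move/eqP/size_poly1P: sr => [d d0 ->].
  by rewrite mul_polyC eqp_sym eqp_scale.
move=> a b [r rE].
have fab : f %| a * b by rewrite rE dvdp_mull.
have [s1|ga] := irr _ (dvdp_gcdl f a).
  right; apply: primitive_dvdp => //.
  by rewrite -(Gauss_dvdpr b (_ : coprimep f a)) // coprimep_def s1.
left; apply: primitive_dvdp => //.
by rewrite -(eqp_dvdl _ ga) dvdp_gcdr.
Qed.

Lemma ufd_poly : ufd R -> ufd {poly R}.
Proof.
move=> uR.
have prim (f : {poly R}) : f != 0 -> primitive f -> factorizable f.
  move: {2}(size f) (leqnn (size f)) => n; elim: n f => [|n IH] f sf f0 fp.
    by move: f0; rewrite -size_poly_eq0 -leqn0 sf.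
  case: (leqP (size f) 1) => s1.
    have/eqP/size_poly1P[c c0 fE] : size f = 1%N.
      by apply/eqP; rewrite eqn_leq s1 size_poly_gt0.
    have [u [[|p s] [uu sp cE]]] := uR c c0.
      apply: factorizable_unit; rewrite fE poly_unitE coefC eqxx size_polyC c0.
      by rewrite cE big_nil mulr1.
    have pp : prime_elt p by apply: sp; rewrite inE eqxx.
    case: (fp p pp); exists ((u * \prod_(i <- s) i)%:P).
    by rewrite fE cE big_cons -polyCM mulrCA mulrC.
  case: (classic (exists g r, [/\ f = g * r, size g != 1%N & size r != 1%N])).
    move=> [g [r [fE sg sr]]].
    have g0 : g != 0 by apply: contraNneq f0 => E; rewrite fE E mul0r.
    have r0 : r != 0 by apply: contraNneq f0 => E; rewrite fE E mulr0.
    have sg2 : (1 < size g)%N by rewrite ltn_neqAle eq_sym sg size_poly_gt0.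
    have sr2 : (1 < size r)%N by rewrite ltn_neqAle eq_sym sr size_poly_gt0.
    have szE : size f = (size g + size r).-1 by rewrite fE size_mul.
    rewrite fE; apply: factorizableM; apply: IH => //.
    - by rewrite -ltnS (leq_trans _ sf) // szE -subn1 ltn_subRL addnC ltn_add2l.
    - by apply: primitive_divisor fp _; exists r; rewrite mulrC.
    - by rewrite -ltnS (leq_trans _ sf) // szE -subn1 ltn_subRL ltn_add2r.
    - by apply: primitive_divisor fp _; exists g.
  move=> nex; apply: factorizable_prime; apply: primitive_irreducible_prime => //.
  move=> g r fE; case: (eqVneq (size g) 1%N) => [|sg]; first by left.
  case: (eqVneq (size r) 1%N) => [|sr]; first by right.
  by case: nex; exists g, r.
move=> f f0; have [c [g [fE c0 cf gp]]] := content_decomposition uR f0.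
rewrite fE; apply: factorizableM => //; apply: prim => //.
by apply: contraNneq f0 => g0; rewrite fE g0 mulr0.
Qed.

End GaussLemma.

(** * Graded ideals and saturation *)

Lemma least_nat (Q : nat -> Prop) : (exists n, Q n) ->
  exists n, Q n /\ forall m, (m < n)%N -> ~ Q m.
Proof.
move=> [n]; elim/ltn_ind: n => n IH Qn.
case: (classic (exists m, (m < n)%N /\ Q m)) => [[m [mn Qm]]|nex]; first exact: IH mn Qm.
by exists n; split=> // m mn Qm; apply: nex; exists m.
Qed.

Lemma greatest_nat (Q : nat -> Prop) N : (exists n, Q n) -> (forall n, Q n -> (n < N)%N) ->
  exists n, Q n /\ forall m, (n < m)%N -> ~ Q m.
Proof.
move=> [n0 Qn0] QN; have [|_ [[n [Qn ->]] mmin]] :=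
    @least_nat (fun m => exists n, Q n /\ m = (N - n)%N).
  by exists (N - n0)%N, n0.
exists n; split=> // m nm Qm; apply: (mmin (N - m)%N); last by exists m.
by rewrite ltn_sub2l // QN.
Qed.

Section Graded.
Variable k : fieldType.
Notation S := {mpoly k[4]}.
Implicit Types (I J K p q : S -> Prop) (f g h : S).
Notation comp d f := (pihomog mdeg d f).

Lemma comp_bound f d : (msize f <= d)%N -> comp d f = 0.
Proof.
move=> fd; rewrite pihomogE big_seq_cond big1 // => m /andP[mf /eqP md].
by have := msize_mdeg_lt mf; rewrite md ltnNge fd.
Qed.

Lemma comp_sum N f : (msize f <= N)%N -> f = \sum_(d < N) comp d f.
Proof. exact: pihomog_partitionE. Qed.

Lemma compE d e f : f \is e.-homog -> comp d f = if e == d then f else 0.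
Proof. by case: eqVneq => [<- /pihomog_dE//|ne fh]; apply: pihomog_ne0 ne fh. Qed.

Lemma compMr d e f g : f \is e.-homog ->
  comp d (g * f) = if (e <= d)%N then comp (d - e) g * f else 0.
Proof.
move=> fh; rewrite {1}(comp_sum (leqnn (msize g))) mulr_suml raddf_sum /=.
have comE (i : nat) : comp d (comp i g * f) =
    if (i + e == d)%N then comp i g * f else 0.
  by apply: compE; apply: dhomogM fh; apply: pihomogP.
under eq_bigr do rewrite comE.
case: (leqP e d) => [ed|de]; last first.
  by apply: big1 => i _; case: eqP => // E; move: de; rewrite -E ltnNge leq_addl.
have idE i : (i + e == d)%N = (i == d - e)%N by rewrite -{1}(subnK ed) eqn_add2r.
case: (ltnP (d - e) (msize g)) => [lt|ge]; last first.
  rewrite comp_bound // mul0r big1 // => i _; rewrite idE; case: eqP => // E.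
  by move: (ltn_ord i); rewrite E ltnNge ge.
rewrite (bigD1 (Ordinal lt)) //= idE eqxx big1 ?addr0 // => i ine.
by rewrite idE; case: eqP => // E; case/eqP: ine; apply: val_inj.
Qed.

Lemma compM n f g : comp n (f * g) = \sum_(i < n.+1) comp i f * comp (n - i) g.
Proof.
have sE := comp_sum (leq_maxl (msize f) n.+1); set N := maxn _ _ in sE.
rewrite {1}sE mulr_suml raddf_sum /=.
rewrite (big_ord_widen N (fun i => comp i f * comp (n - i) g)) ?leq_maxr // [RHS]big_mkcond /=.
apply: eq_bigr => i _; rewrite mulrC (compMr _ _ (pihomogP _ i f)) ltnS.
by case: ifP; rewrite 1?mulrC.
Qed.

Lemma homogX i : ('X_i : S) \is 1.-homog. Proof. by rewrite dhomogX /= mdeg1. Qed.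

Lemma ideal_opp I f : ideal I -> I f -> I (- f).
Proof. by move=> [_ _ IM] If; rewrite -mulN1r; apply: IM. Qed.

Lemma ideal_sub I f g : ideal I -> I f -> I g -> I (f - g).
Proof. by move=> Iid If Ig; have [_ ID _] := Iid; apply: ID => //; apply: ideal_opp. Qed.

Lemma ideal_mulr I f g : ideal I -> I f -> I (f * g).
Proof. by move=> [_ _ IM] If; rewrite mulrC; apply: IM. Qed.

Lemma ideal_scale I c f : ideal I -> I f -> I (c *: f).
Proof. by move=> [_ _ IM] If; rewrite -mul_mpolyC; apply: IM. Qed.

Lemma ideal_sum I (T : Type) (r : seq T) (P : pred T) (F : T -> S) : ideal I ->
  (forall i, P i -> I (F i)) -> I (\sum_(i <- r | P i) F i).
Proof. by move=> [I0 ID _] IF; elim/big_ind: _. Qed.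

Lemma ideal_subK I f g : ideal I -> I (f - g) -> I g -> I f.
Proof. by move=> [_ ID _] Ifg Ig; rewrite -(subrK g f); apply: ID. Qed.

Lemma ideal_comp I f : ideal I -> (forall d, I (comp d f)) -> I f.
Proof. by move=> Iid H; rewrite (comp_sum (leqnn (msize f))); apply: ideal_sum. Qed.

Lemma homog_ideal_ext I J : homogeneous_ideal I -> ideal J ->
  (forall d f, f \is d.-homog -> I f -> J f) -> forall f, I f -> J f.
Proof.
move=> [_ Ih] Jid IJ f If; apply: ideal_comp => // d.
by apply: (IJ d); [apply: pihomogP | apply: Ih].
Qed.

Lemma notin_comp I f : ideal I -> ~ I f -> exists d, ~ I (comp d f).
Proof. by move=> Iid nIf; apply: not_all_ex_not => /(ideal_comp Iid). Qed.

Lemma ideal_comp_product I f g d e : ideal I -> I (comp (d + e) (f * g)) ->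
  (forall i j, (i + j = d + e)%N -> i <> d -> I (comp i f * comp j g)) ->
  I (comp d f * comp e g).
Proof.
move=> Iid Ifg H; move: Ifg; rewrite compM.
have lt : (d < (d + e).+1)%N by rewrite ltnS leq_addr.
rewrite (bigD1 (Ordinal lt)) //= addKn => E.
rewrite -[X in I X](addrK (\sum_(i < (d + e).+1 | i != Ordinal lt)
  comp i f * comp (d + e - i) g)).
apply: ideal_sub => //; apply: ideal_sum => // i ine; apply: H.
  by rewrite subnKC // -ltnS.
by move=> E'; case/eqP: ine; apply: val_inj.
Qed.

Lemma top_comp I f : ideal I -> ~ I f ->
  exists d, ~ I (comp d f) /\ forall i, (d < i)%N -> I (comp i f).
Proof.
move=> Iid nIf; have [||d [Id dmax]] := @greatest_nat (fun d => ~ I (comp d f)) (msize f).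
- exact: notin_comp.
- move=> n nI; rewrite ltnNge; apply/negP => /comp_bound E.
  by apply: nI; rewrite E; case: Iid.
by exists d; split=> // i /dmax/NNPP.
Qed.

Lemma bot_comp I f : ideal I -> ~ I f ->
  exists d, ~ I (comp d f) /\ forall i, (i < d)%N -> I (comp i f).
Proof.
move=> Iid /(notin_comp Iid)/least_nat[d [Id dmin]].
by exists d; split=> // i /dmin/NNPP.
Qed.

Definition prime_ideal p : Prop :=
  [/\ ideal p, ~ p 1 & forall f g, p (f * g) -> p f \/ p g].

(** If neither factor were in [p], the product of their highest components outside [p] would be,
    modulo [p], a component of the product. *)
Lemma homog_prime p : homogeneous_ideal p ->
  (forall d e f g, f \is d.-homog -> g \is e.-homog -> p (f * g) -> p f \/ p g) ->
  forall f g, p (f * g) -> p f \/ p g.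
Proof.
move=> ph pp f g pfg; have [pid pc] := ph; apply: NNPP => /not_or_and[pf pg].
have [d [fd dmax]] := top_comp pid pf; have [e [ge emax]] := top_comp pid pg.
have [|//|//] := pp d e _ _ (pihomogP _ d f) (pihomogP _ e g).
apply: ideal_comp_product (pc _ _ pfg) _ => // i j ij id.
case: (ltngtP d i) => [di|di|E]; last by rewrite E in id.
  by apply: ideal_mulr => //; apply: dmax.
have ej : (e < j)%N by rewrite -(ltn_add2l d) -ij ltn_add2r.
by have [_ _ pM] := pid; apply: pM; apply: emax.
Qed.

(** The sum of [I] and the ideal of [f], with membership reduced to a single coefficient [c];
    nesting it gives the ideals with several generators used below. *)
Definition adj I f : S -> Prop := fun g => exists c, I (g - c * f).

Lemma adj_ideal I f : ideal I -> ideal (adj I f).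
Proof.
move=> [I0 ID IM]; split.
- by exists 0; rewrite mul0r subr0.
- move=> a b [c Ic] [d Id]; exists (c + d).
  by rewrite (_ : _ - _ = (a - c * f) + (b - d * f)); [apply: ID|ring].
- move=> a b [c Ic]; exists (a * c).
  by rewrite (_ : _ - _ = a * (b - c * f)); [apply: IM|ring].
Qed.

Lemma adjW I f g : I g -> adj I f g.
Proof. by move=> Ig; exists 0; rewrite mul0r subr0. Qed.

Lemma adj_gen I f : ideal I -> adj I f f.
Proof. by move=> [I0 _ _]; exists 1; rewrite mul1r subrr. Qed.

Lemma adj_sub I J f : ideal J -> (forall g, I g -> J g) -> J f -> forall g, adj I f g -> J g.
Proof. by move=> Jid IJ Jf g [c /IJ H]; apply: (ideal_subK Jid H); case: Jid => _ _; apply. Qed.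

Lemma adj_homog I d f : homogeneous_ideal I -> f \is d.-homog ->
  homogeneous_ideal (adj I f).
Proof.
move=> [Iid Ih] fh; split=> [|g n [c Ic]]; first exact: adj_ideal.
exists (if (d <= n)%N then comp (n - d) c else 0); move: (Ih _ n Ic).
by rewrite raddfB /= (compMr _ _ fh); case: ifP; rewrite ?mul0r.
Qed.

Lemma adj_witness I d e f g : homogeneous_ideal I -> f \is d.-homog -> g \is e.-homog ->
  adj I f g -> ~ I g -> (d <= e)%N /\ exists c, c \is (e - d).-homog /\ I (g - c * f).
Proof.
move=> [Iid Ih] fh gh [c Ic] nIg; move: (Ih _ e Ic).
rewrite raddfB /= (compMr _ _ fh) (pihomog_dE gh); case: ifP => [de H|_].
  by split=> //; exists (comp (e - d) c); split=> //; apply: pihomogP.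
by rewrite subr0.
Qed.

Lemma principal_ideal f : ideal (principal f).
Proof.
split; first by exists 0; rewrite mul0r.
- by move=> a b [c ->] [d ->]; exists (c + d); rewrite mulrDl.
- by move=> a b [c ->]; exists (a * c); rewrite mulrA.
Qed.

Lemma principal_homog d f : f \is d.-homog -> homogeneous_ideal (principal f).
Proof.
move=> fh; split=> [|g n [c ->]]; first exact: principal_ideal.
rewrite (compMr _ _ fh); case: ifP => _; last by exists 0; rewrite mul0r.
by exists (comp (n - d) c).
Qed.

Lemma principal_sub I f : ideal I -> I f -> forall g, principal f g -> I g.
Proof. by move=> [_ _ IM] If g [c ->]; apply: IM. Qed.

Definition colon1 I f : S -> Prop := fun g => I (g * f).

Lemma colon1_ideal I f : ideal I -> ideal (colon1 I f).
Proof.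
move=> [I0 ID IM]; split; rewrite /colon1 ?mul0r //.
  by move=> a b Ha Hb; rewrite mulrDl; apply: ID.
by move=> a b H; rewrite -mulrA; apply: IM.
Qed.

Lemma colon1_homog I d f : homogeneous_ideal I -> f \is d.-homog ->
  homogeneous_ideal (colon1 I f).
Proof.
move=> [Iid Ih] fh; split=> [|g n Ig]; first exact: colon1_ideal.
by rewrite /colon1; move: (Ih _ (n + d)%N Ig); rewrite (compMr _ _ fh) leq_addl addnK.
Qed.

Definition saturated I := forall f, saturation I f -> I f.

Lemma colon1_saturated I f : saturated I -> saturated (colon1 I f).
Proof.
move=> Isat g [N H]; apply: Isat; exists N => m md.
by rewrite mulrA; apply: H.
Qed.

Lemma saturationW I f : ideal I -> I f -> saturation I f.
Proof. by move=> [_ _ IM] If; exists 0%N => m _; apply: IM. Qed.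

Lemma mnm_split N (m : 'X_{1..4}) : (N <= mdeg m)%N ->
  exists2 m1 : 'X_{1..4}, mdeg m1 = N & (m1 <= m)%MM.
Proof.
elim: N => [|N IH] Nm.
  by exists 0%MM; [rewrite mdeg0 | apply/mnm_lepP => i; rewrite mnm0E].
have [m1 m1N /mnm_lepP m1m] := IH (ltnW Nm).
have [i im] : exists i, (m1 i < m i)%N.
  apply: NNPP => nex; have : (mdeg m <= mdeg m1)%N.
    rewrite !mdegE; apply: leq_sum => i _; rewrite leqNgt; apply/negP => lt.
    by apply: nex; exists i.
  by rewrite m1N leqNgt Nm.
exists (m1 + U_(i))%MM; first by rewrite mdegD mdeg1 m1N addn1.
apply/mnm_lepP => j; rewrite mnmDE mnm1E; case: eqP => [<-|_]; first by rewrite addn1.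
by rewrite addn0.
Qed.

Lemma saturationP I f : ideal I -> saturation I f ->
  exists N, forall d g, (N <= d)%N -> g \is d.-homog -> I (g * f).
Proof.
move=> Iid [N H]; exists N => d g Nd gh; rewrite (mpolyE g) mulr_suml.
rewrite big_seq; apply: ideal_sum => // m mg.
rewrite -scalerAl; apply: ideal_scale => //.
have md : mdeg m = d by move/dhomogP: gh => /(_ m mg).
have [|m1 m1N m1m] := @mnm_split N m; first by rewrite md.
rewrite -(submK m1m) mpolyXD -mulrA; have [_ _ IM] := Iid; apply: IM; exact: H.
Qed.

Lemma saturation_homogP I f :
  (exists N, forall d g, (N <= d)%N -> g \is d.-homog -> I (g * f)) -> saturation I f.
Proof. by move=> [N H]; exists N => m mN; apply: (H N); rewrite // dhomogX /= mN. Qed.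

Lemma saturation_ideal I : ideal I -> ideal (saturation I).
Proof.
move=> Iid; split; first by apply: saturationW => //; case: Iid.
  move=> f g /(saturationP Iid)[M HM] /(saturationP Iid)[N HN].
  apply: saturation_homogP => //; exists (maxn M N) => d a; rewrite geq_max => /andP[Md Nd] ah.
  by rewrite mulrDr; have [_ ID _] := Iid; apply: ID; [apply: HM ah | apply: HN ah].
move=> f g [N H]; exists N => m mN; rewrite mulrCA; have [_ _ IM] := Iid.
by apply: IM; apply: H.
Qed.

Lemma saturation_homog I : homogeneous_ideal I -> homogeneous_ideal (saturation I).
Proof.
move=> [Iid Ih]; split=> [|f d /(saturationP Iid)[N H]]; first exact: saturation_ideal.
apply: saturation_homogP => //; exists N => e a Ne ah.
move: (Ih _ (d + e)%N (H e a Ne ah)); rewrite mulrC (compMr _ _ ah) leq_addl addnK.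
by rewrite mulrC.
Qed.

Lemma saturation_saturated I : ideal I -> saturated (saturation I).
Proof.
move=> Iid f [N H].
(* There are finitely many monomials of degree [N], so one exponent [M] serves for all of them. *)
have [M HM] : exists M, forall m : 'X_{1..4}, mdeg m = N ->
    forall d g, (M <= d)%N -> g \is d.-homog -> I (g * ('X_[m] * f)).
  have fin (s : seq 'X_{1..4}) : exists M, forall m, m \in s -> mdeg m = N ->
    forall d g, (M <= d)%N -> g \is d.-homog -> I (g * ('X_[m] * f)).
    elim: s => [|m s [M IH]]; first by exists 0%N.
    case: (eqVneq (mdeg m) N) => [mN|mN].
      have [M' HM'] := saturationP Iid (H m mN).
      exists (maxn M M') => m'; rewrite inE => /orP[/eqP->|m's] m'N d g;
        rewrite geq_max => /andP[Md M'd] gh; first exact: HM' gh.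
      exact: IH gh.
    exists M => m'; rewrite inE => /orP[/eqP->|m's] m'N; first by rewrite m'N eqxx in mN.
    exact: IH.
  have [M HM] := fin [seq val m | m : 'X_{1..4 < N.+1}]; exists M => m mN.
  apply: HM => //; have mb : (mdeg m < N.+1)%N by rewrite mN.
  by apply/mapP; exists (BMultinom mb); rewrite ?mem_enum.
exists (M + N)%N => m mNM; have [|m1 m1N m1m] := @mnm_split N m.
  by rewrite mNM leq_addl.
rewrite -(submK m1m) mpolyXD -mulrA; apply: (HM m1 m1N (mdeg (m - m1)%MM)).
  by rewrite -(leq_add2r N) -{2}m1N -mdegD submK // mNM.
by rewrite dhomogX.
Qed.

End Graded.

(** * The coordinate ring of the plane *)

Section Extend.
Variables (R T : comNzRingType) (phi : {rmorphism R -> T}) (t : T).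

Definition extend : {rmorphism {poly R} -> T} :=
  horner_morph (fun x => mulrC t (phi x) : GRing.comm t (phi x)).

Lemma extendC a : extend a%:P = phi a. Proof. exact: horner_morphC. Qed.
Lemma extendX : extend 'X = t. Proof. exact: horner_morphX. Qed.

End Extend.

Lemma rmorph_poly_eq (R T : comNzRingType) (f g : {rmorphism {poly R} -> T}) :
  (forall a, f a%:P = g a%:P) -> f 'X = g 'X -> f =1 g.
Proof.
move=> fgC fgX; elim/poly_ind => [|p a IH]; first by rewrite !rmorph0.
by rewrite !rmorphD !rmorphM IH fgX fgC.
Qed.

Lemma mpoly_gen_ind n (R : comNzRingType) (P : {mpoly R[n]} -> Prop) :
  (forall c, P c%:MP) -> (forall i, P 'X_i) ->
  (forall f g, P f -> P g -> P (f + g)) -> (forall f g, P f -> P g -> P (f * g)) ->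
  forall f, P f.
Proof.
move=> PC PX PD PM f; rewrite (mpolyE f); apply: big_ind; [exact: (PC 0)|exact: PD|].
move=> m _; rewrite -mul_mpolyC; apply: (PM) => //; rewrite mpolyXE_id.
apply: big_ind; [exact: (PC 1)|exact: PM|] => i _.
by elim: (m i) => [|e IH]; [exact: (PC 1) | rewrite exprS; apply: PM].
Qed.

Section Noetherian.
Variable k : fieldType.
Notation S := {mpoly k[4]}.

Lemma noetherian_S : noetherian S.
Proof.
pose e0 : {rmorphism k -> S} := @mpolyC 4 k.
pose e1 := extend e0 'X_(inord 0); pose e2 := extend e1 'X_(inord 1).
pose e3 := extend e2 'X_(inord 2); pose e4 := extend e3 'X_(inord 3).
apply: (noetherian_image (phi := e4)); last first.
  by do 4!apply: noetherian_poly; apply: noetherian_field.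
apply: mpoly_gen_ind => [c|i|_ _ [a <-] [b <-]|_ _ [a <-] [b <-]].
- by exists c%:P%:P%:P%:P; rewrite !extendC.
- have [E|[E|[E|E]]] : i = inord 0 \/ i = inord 1 \/ i = inord 2 \/ i = inord 3.
    have eq j : (val i == j) -> (j < 4)%N -> i = inord j.
      by move=> /eqP ij j4; apply: val_inj; rewrite /= inordK.
    case: i eq => [[|[|[|[|//]]]] Hi] eq.
    + by left; apply: eq.
    + by right; left; apply: eq.
    + by do 2!right; left; apply: eq.
    + by do 3!right; apply: eq.
  + by exists 'X%:P%:P%:P; rewrite !extendC extendX E.
  + by exists 'X%:P%:P; rewrite !extendC extendX E.
  + by exists 'X%:P; rewrite !extendC extendX E.
  + by exists 'X; rewrite !extendX E.
- by exists (a + b); rewrite rmorphD.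
- by exists (a * b); rewrite rmorphM.
Qed.

Lemma ideal_gens (I : S -> Prop) : ideal I ->
  exists s : seq S, (forall x, x \in s -> I x) /\
    forall J, ideal J -> (forall x, x \in s -> J x) -> forall f, I f -> J f.
Proof. exact: noetherian_S. Qed.

(** Without a maximal member, iterating a choice of strictly larger members gives an ascending chain
    whose union, being finitely generated, is already reached at a finite stage. *)
Lemma maximal_ideal_of (Q : (S -> Prop) -> Prop) : (forall I, Q I -> ideal I) ->
  (exists I, Q I) ->
  exists M, Q M /\ forall I, Q I -> (forall f, M f -> I f) -> forall f, I f -> M f.
Proof.
move=> Qid [I0 QI0]; apply: NNPP => nex.
have next I : exists J, Q I -> [/\ Q J, forall f, I f -> J f & exists f, J f /\ ~ I f].
  case: (classic (Q I)) => [QI|nQ]; last by exists I.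
  apply: NNPP => nJ; apply: nex; exists I; split=> // J QJ IJ f Jf.
  by apply: NNPP => nIf; apply: nJ; exists J => _; split=> //; exists f.
have [F HF] := choice _ next; pose c n := iter n F I0.
have Qc n : Q (c n) by elim: n => //= n IH; have [] := HF _ IH.
have cS n f : c n f -> c n.+1 f by have [_ + _] := HF _ (Qc n); apply.
have cle m n f : (m <= n)%N -> c m f -> c n f.
  by move=> mn cf; rewrite -(subnK mn); elim: (n - m)%N => //= d IH; apply: cS.
have uid : ideal (fun f => exists n, c n f).
  split=> [|f g [m cf] [n cg]|f g [n cg]].
  - by exists 0%N; have [] := Qid _ QI0.
  - exists (maxn m n); have [_ + _] := Qid _ (Qc (maxn m n)); apply.
      exact: cle (leq_maxl _ _) cf.
    exact: cle (leq_maxr _ _) cg.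
  - by exists n; have [_ _] := Qid _ (Qc n); apply.
have [s [sU Us]] := ideal_gens uid.
have [N sN] : exists N, forall x, x \in s -> c N x.
  elim: s sU {Us} => [|x s IH] sU; first by exists 0%N.
  have [y ys|N sN] := IH; first by apply: sU; rewrite inE ys orbT.
  have [|n cx] := sU x; first by rewrite inE eqxx.
  exists (maxn N n) => y; rewrite inE => /orP[/eqP->|/sN cy].
    exact: cle (leq_maxr _ _) cx.
  exact: cle (leq_maxl _ _) cy.
have [_ _ [f [cf ncf]]] := HF _ (Qc N); apply: ncf.
by apply: (Us _ (Qid _ (Qc N)) sN); exists N.+1.
Qed.

End Noetherian.

Section Plane.
Variables (k : fieldType) (h : {mpoly k[4]}).
Hypotheses (h_linear : h \is 1.-homog) (h_neq0 : h != 0).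
Notation S := {mpoly k[4]}.
Notation A := {poly {poly {poly k}}}.
Notation H := (principal h).

Lemma linear_formE (l : S) : l \is 1.-homog -> l = \sum_i l@_U_(i) *: 'X_i.
Proof.
move=> lh; apply/mpolyP => m; rewrite raddf_sum /=.
under eq_bigr do rewrite mcoeffZ mcoeffX.
case: (boolP (mdeg m == 1%N)) => [/mdeg1P[j /eqP->]|m1].
  rewrite (bigD1 j) //= eqxx mulr1 big1 ?addr0 // => i ij.
  by rewrite eq_mnm1 (negbTE ij) mulr0.
rewrite (dhomog_nemf_coeff lh m1) big1 // => i _; case: eqP => [E|]; last by rewrite mulr0.
by rewrite -E mdeg1 eqxx in m1.
Qed.

Lemma linear_form_coef_neq0 : exists i, h@_U_(i) != 0.
Proof.
apply: NNPP => nex; case/negP: h_neq0; rewrite (linear_formE h_linear) big1 // => i _.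
by case: (eqVneq h@_U_(i) 0) => [->|hi]; [rewrite scale0r | case: nex; exists i].
Qed.

(** [B] is kept abstract: all that matters about the polynomial ring in three variables is its
    constants [c], its variables [v], and that an endomorphism fixing both is the identity. *)
Lemma eliminate_variable (B : comNzRingType) (c : {rmorphism k -> B}) (v : 'I_3 -> B)
    (psi : {rmorphism B -> S}) (i : 'I_4) :
  h@_U_(i) != 0 -> (forall a, psi (c a) = a%:MP) -> (forall j, psi (v j) = 'X_(lift i j)) ->
  (forall F : {rmorphism B -> B}, (forall a, F (c a) = c a) -> (forall j, F (v j) = v j) ->
     forall a, F a = a) ->
  exists phi : {rmorphism S -> B},
    [/\ forall a, phi (psi a) = a, phi h = 0 & forall f, H (psi (phi f) - f)].
Proof.
move=> hi psiC psiv Buniq.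
(* The value of the eliminated variable, obtained by solving [h = 0] for it. *)
pose w := - \sum_j c (h@_U_(lift i j) / h@_U_(i)) * v j.
pose vv (m : 'I_4) : B := oapp v w (unlift i m).
have [phi phiC phiX] : exists2 phi : {rmorphism S -> B},
    forall a, phi a%:MP = c a & forall m, phi 'X_m = vv m.
  exists (mmap c vv) => [a|m]; first exact: mmapC.
  by rewrite /= mmapX mmap1U.
have phix j : phi 'X_(lift i j) = v j by rewrite phiX /vv liftK.
have phi_i : phi 'X_i = w by rewrite phiX /vv unlift_none.
have cM a : c a = c h@_U_(i) * c (a / h@_U_(i)).
  by rewrite -rmorphM mulrC divfK.
exists phi; split.
- apply: (Buniq (phi \o psi)) => [a|j] /=; first by rewrite psiC phiC.
  by rewrite psiv phix.
- rewrite {1}(linear_formE h_linear) rmorph_sum (bigD1_ord i) //=.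
  rewrite -mul_mpolyC rmorphM phiC phi_i mulrN mulr_sumr addrC -sumrB big1 // => j _.
  by rewrite -mul_mpolyC rmorphM phiC phix [c h@_U_(lift i j)]cM mulrA subrr.
have Hid := principal_ideal h; have [H0 HD HM] := Hid.
apply: mpoly_gen_ind => [a|m|f g Hf Hg|f g Hf Hg].
- by rewrite phiC psiC subrr.
- case: (unliftP i m) => [j ->|->]; first by rewrite phix psiv subrr.
  exists (- (h@_U_(i))^-1%:MP); rewrite {2}(linear_formE h_linear) (bigD1_ord i) //=.
  rewrite phi_i rmorphN rmorph_sum /= mulrDr -scalerAr mulNr mul_mpolyC -scalerN scalerA.
  rewrite divff // scale1r addrC; congr (_ + _); rewrite mulr_sumr -sumrN.
  apply: eq_bigr => j _.
  by rewrite rmorphM psiC psiv mulNr -!mul_mpolyC mulrA -mpolyCM [_^-1 * _]mulrC.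
- by rewrite !rmorphD opprD addrACA; apply: HD.
- rewrite !rmorphM (_ : _ - _ = psi (phi f) * (psi (phi g) - g) + g * (psi (phi f) - f)).
    by apply: HD; apply: HM.
  by ring.
Qed.

(** [phi] is restriction to the plane, with kernel exactly (h), and [psi] is a section of it. The
    target is an iterated polynomial ring so that [ufd_poly] applies three times. *)
Lemma plane_coordinates : exists (phi : {rmorphism S -> A}) (psi : {rmorphism A -> S}),
  [/\ forall a, phi (psi a) = a, phi h = 0 & forall f, H (psi (phi f) - f)].
Proof.
have [i hi] := linear_form_coef_neq0.
pose c0 : {rmorphism k -> {poly k}} := polyC.
pose c1 : {rmorphism {poly k} -> {poly {poly k}}} := polyC.
pose c2 : {rmorphism {poly {poly k}} -> A} := polyC.
pose v (j : 'I_3) : A := tnth [tuple 'X%:P%:P; 'X%:P; 'X] j.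
pose e0 : {rmorphism k -> S} := @mpolyC 4 k.
pose x j : S := 'X_(lift i (inord j)).
pose e1 := extend e0 (x 0%N); pose e2 := extend e1 (x 1%N); pose e3 := extend e2 (x 2%N).
have vE : [/\ v (inord 0) = 'X%:P%:P, v (inord 1) = 'X%:P & v (inord 2) = 'X].
  by rewrite /v !(tnth_nth 0) !inordK.
have [v0 v1 v2] := vE.
have [a|j|F Fc Fv|phi Hphi] := @eliminate_variable A (c2 \o (c1 \o c0)) v e3 i hi.
- by rewrite /= !extendC.
- have [->|->|->] : [\/ j = inord 0, j = inord 1 | j = inord 2].
    have eq m : (val j == m) -> (m < 3)%N -> j = inord m.
      by move=> /eqP jm m3; apply: val_inj; rewrite /= inordK.
    by case: j eq => [[|[|[|//]]] Hj] eq; [apply: Or31|apply: Or32|apply: Or33]; exact: eq.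
  + by rewrite v0 !extendC extendX.
  + by rewrite v1 extendC extendX.
  + by rewrite v2 extendX.
- apply: (rmorph_poly_eq (g := idfun)) => [a|]; last by rewrite /= -v2 Fv.
  apply: (rmorph_poly_eq (f := F \o c2) (g := c2)) => [{}a|]; last by rewrite /= -v1 Fv.
  apply: (rmorph_poly_eq (f := F \o (c2 \o c1)) (g := c2 \o c1)) => [{}a|].
    exact: Fc.
  by rewrite /= -v0 Fv.
by exists phi, e3.
Qed.

Lemma plane_prime : prime_ideal H.
Proof.
have [phi [psi [phiK phih Hpsi]]] := plane_coordinates.
have Hphi f : H f <-> phi f = 0.
  split=> [[a ->]|f0]; first by rewrite rmorphM phih mulr0.
  have := Hpsi f; rewrite f0 rmorph0 sub0r => /(ideal_opp (principal_ideal h)).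
  by rewrite opprK.
split; first exact: principal_ideal.
  by move/Hphi; rewrite rmorph1 => /eqP; rewrite oner_eq0.
move=> f g /Hphi; rewrite rmorphM => /eqP; rewrite mulf_eq0 => /orP[]/eqP E.
  by left; apply/Hphi.
by right; apply/Hphi.
Qed.

(** Geometrically, [pi] is an integral curve through [p] contained in the plane curve [g]. Unique
    factorization gives a prime factor [q] of [phi g] in [p], but [phi] forgets the grading, so [q]
    still has to be replaced by a form. *)
Lemma plane_homog_prime_factor n g (p : S -> Prop) :
  g \is n.-homog -> ~ H g -> prime_ideal p -> p h -> p g ->
  exists d pi, [/\ pi \is d.-homog, p pi, ~ H pi, prime_ideal (adj H pi) & adj H pi g].
Proof.
move=> gh nHg [pid p1 pp] ph pg.
have [phi [psi [phiK phih Hpsi]]] := plane_coordinates.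
have Hid := principal_ideal h; have Hp := principal_sub pid ph.
have [_ _ Hprime] := plane_prime; have [_ HD HM] := Hid.
have phi0 : phi g != 0.
  apply/eqP => E; apply: nHg; have := Hpsi g.
  by rewrite E rmorph0 sub0r => /(ideal_opp Hid); rewrite opprK.
have [u [s [uu sp phigE]]] := ufd_poly (ufd_poly (ufd_poly (@ufd_field k))) phi0.
have pphi : p (psi (phi g)).
  by have [_ pD _] := pid; rewrite -(subrK g (psi _)); apply: pD => //; apply: Hp.
have [q qs [pq qg]] : exists2 q, q \in s & p (psi q) /\ divides q (phi g).
  have : p (psi (\prod_(q <- s) q)).
    move: pphi; rewrite phigE rmorphM => /pp[pu|//]; case: p1.
    move/unitrP: uu => [v [vu _]]; rewrite -(rmorph1 psi) -vu rmorphM.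
    by have [_ _] := pid; apply.
  have sdiv q : q \in s -> divides q (phi g).
    move=> qs; rewrite phigE (perm_big _ (perm_to_rem qs)) big_cons /=.
    by exists (u * \prod_(j <- rem q s) j); ring.
  elim: {phigE sp} s sdiv => [|q s IH] sdiv; first by rewrite big_nil rmorph1.
  rewrite big_cons rmorphM => /pp[pq|ps].
    by exists q; rewrite ?inE ?eqxx //; split=> //; apply: sdiv; rewrite inE eqxx.
  have [|r rs Hr] := IH _ ps; last by exists r; rewrite // inE rs orbT.
  by move=> r rs; apply: sdiv; rewrite inE rs orbT.
have qprime := sp q qs; have [q0 qu qp] := qprime.
have divP f : divides q (phi f) -> adj H (psi q) f.
  move=> [c cE]; exists (psi c); rewrite -opprB; apply: ideal_opp => //.
  by rewrite -rmorphM -cE; apply: Hpsi.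
have Pdiv f : adj H (psi q) f -> divides q (phi f).
  move=> [c [a E]]; exists (phi c); apply/eqP; rewrite -subr_eq0; apply/eqP.
  by rewrite -[X in _ * X](phiK q) -rmorphM -rmorphB E rmorphM phih mulr0.
have Kprime : prime_ideal (adj H (psi q)).
  split; first exact: adj_ideal.
    by move/Pdiv; rewrite rmorph1 => /divides1; apply/negP.
  by move=> a b /Pdiv; rewrite rmorphM => /qp[] /divP; [left|right].
(* Modulo [h], a factor of a form is a form: in a product of two elements of the
   graded domain S / (h), the top and bottom components multiply. *)
have [r Hr] := divP g qg.
have Hh := principal_homog h_linear.
have nHq : ~ H (psi q).
  by move=> Hq; apply: nHg; apply: (ideal_subK Hid Hr); apply: HM.
have nHr : ~ H r.
  by move=> Hr'; apply: nHg; apply: (ideal_subK Hid Hr); apply: ideal_mulr.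
have extremal d e : ~ H (pihomog mdeg d (psi q)) -> ~ H (pihomog mdeg e r) ->
    (forall i j, (i + j = d + e)%N -> i <> d ->
       H (pihomog mdeg i (psi q) * pihomog mdeg j r)) -> n = (d + e)%N.
  move=> qd re Hij; apply: NNPP => nde.
  suff /Hprime[] : H (pihomog mdeg d (psi q) * pihomog mdeg e r) by [].
  apply: ideal_comp_product => //.
  have := Hh.2 _ (d + e)%N Hr; rewrite raddfB /= (compE _ gh).
  by case: eqP => // _; rewrite sub0r mulrC => /(ideal_opp Hid); rewrite opprK.
have [d [qd dtop]] := top_comp Hid nHq; have [e [re etop]] := top_comp Hid nHr.
have [d' [qd' dbot]] := bot_comp Hid nHq; have [e' [re' ebot]] := bot_comp Hid nHr.
have nde : n = (d + e)%N.
  apply: extremal => // i j ij id; case: (ltngtP d i) => [di|di|E]; last by rewrite E in id.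
    by apply: ideal_mulr => //; apply: dtop.
  by apply: HM; apply: etop; rewrite -(ltn_add2l d) -ij ltn_add2r.
have nde' : n = (d' + e')%N.
  apply: extremal => // i j ij id; case: (ltngtP d' i) => [di|di|E]; last by rewrite E in id.
    by apply: HM; apply: ebot; rewrite -(ltn_add2l d') -ij ltn_add2r.
  by apply: ideal_mulr => //; apply: dbot.
have le_d' : (d' <= d)%N by rewrite leqNgt; apply/negP => /dbot.
have le_e' : (e' <= e)%N by rewrite leqNgt; apply/negP => /ebot.
have dd' : d' = d.
  apply/eqP; rewrite eqn_leq le_d' -(leq_add2r e) -nde nde' leq_add2l //.
(* Top and bottom degrees of [psi q] modulo [h] coincide, so all its components except the one of
   degree [d] lie in (h). *)
have Hq : H (psi q - pihomog mdeg d (psi q)).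
  apply: ideal_comp => // i; rewrite raddfB /= (compE _ (pihomogP _ d _)).
  case: (ltngtP d i) => [di|di|->]; last by rewrite subrr; have [] := Hid.
    by rewrite subr0; apply: dtop.
  by rewrite subr0; apply: dbot; rewrite dd'.
have adjE f : adj H (psi q) f <-> adj H (pihomog mdeg d (psi q)) f.
  split=> -[a Ha]; exists a.
    rewrite (_ : _ - _ = (f - a * psi q) + a * (psi q - pihomog mdeg d (psi q))); last by ring.
    by apply: HD => //; apply: HM.
  rewrite (_ : _ - _ = (f - a * pihomog mdeg d (psi q)) - a * (psi q - pihomog mdeg d (psi q))).
    by apply: ideal_sub => //; apply: HM.
  by ring.
exists d, (pihomog mdeg d (psi q)); split=> //.
- exact: pihomogP.
- by apply: (ideal_subK pid) pq; rewrite -opprB; apply: ideal_opp => //; apply: Hp.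
- have [_ K1 Kp] := Kprime; split; first exact: adj_ideal.
    by move/adjE.
  by move=> a b /adjE/Kp[] /adjE; [left|right].
- by apply/adjE; apply: divP.
Qed.

End Plane.

(** * Associated points *)

Section Points.
Variable k : fieldType.
Notation S := {mpoly k[4]}.
Implicit Types (I J K X p q : S -> Prop) (f g h : S).

Lemma point_prime p : point p -> prime_ideal p.
Proof. by move=> [[? _] ? ? _]; split. Qed.

(** An annihilator maximal among those of the multiples of [g] by forms is prime: if [a * (g * s)]
    is not in [I], the annihilator of [g * (s * a)] contains the maximal one, hence equals it, and
    it contains [b]. *)
Lemma associated_point_exists I d g : homogeneous_ideal I -> saturated I ->
  g \is d.-homog -> ~ I g ->
  exists e s, [/\ s \is e.-homog, ~ I (g * s) & point (colon1 I (g * s))].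
Proof.
move=> Ih Isat gh nIg; have [Iid _] := Ih.
pose Q J := exists e s, [/\ s \is e.-homog, ~ I (g * s) & J = colon1 I (g * s)].
have [J [e [s [sh ngs ->]]]||M [[e [s [sh ngs ME]]] Mmax]] := @maximal_ideal_of k Q.
- exact: colon1_ideal.
- by exists (colon1 I g), 0%N, 1; rewrite mulr1; split=> //; apply: dhomog1.
exists e, s; rewrite -ME; have gsh := dhomogM gh sh; have Mh : homogeneous_ideal M.
  by rewrite ME; apply: colon1_homog gsh.
split=> //; split=> //; first by rewrite ME /colon1 mul1r.
  apply: homog_prime => // m n a b ah bh; rewrite ME {2}/colon1 => Iab.
  case: (classic (I (a * (g * s)))) => [|na]; [by left|right].
  rewrite -ME; apply: (Mmax (colon1 I (g * (s * a)))).
  - exists (e + m)%N, (s * a); split=> //; first exact: dhomogM.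
    by rewrite (_ : g * (s * a) = a * (g * s)) //; ring.
  - move=> f; rewrite ME /colon1 => If.
    by rewrite (_ : _ * _ = f * (g * s) * a); [apply: ideal_mulr | ring].
  - by rewrite /colon1 (_ : _ * _ = a * b * (g * s)) //; ring.
(* If every variable annihilated [g * s] modulo [I], saturation would put [g * s] in [I]. *)
apply: NNPP => nex; apply: ngs; apply: Isat; exists 1%N => m /eqP/mdeg1P[i /eqP->].
have : M 'X_i by apply: NNPP => nM; apply: nex; exists i.
by rewrite ME.
Qed.

Lemma associated_colon1 I f : point (colon1 I f) -> associated_point I (colon1 I f).
Proof. by move=> pp; split=> //; exists f. Qed.

Lemma nonzerodivisor I x d g : homogeneous_ideal I -> saturated I ->
  (forall p, associated_point I p -> ~ p x) -> g \is d.-homog -> I (x * g) -> I g.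
Proof.
move=> Ih Isat xI gh Ixg; apply: NNPP => nIg.
have [e [s [_ _ /associated_colon1/xI]]] := associated_point_exists Ih Isat gh nIg.
by apply; rewrite /colon1 mulrA; apply: ideal_mulr; case: Ih.
Qed.

(** A form outside C has a multiple whose annihilator modulo C is an associated point, which is
    generic as C has no embedded points; the multiplier given for that point cannot lie outside
    it. *)
Lemma in_curve (C : S -> Prop) d g : curve C -> g \is d.-homog ->
  (forall q, generic_point C q -> exists s, ~ q s /\ C (s * g)) -> C g.
Proof.
move=> [[Ch Csat] _ _ Cass] gh Hq; apply: NNPP => nCg.
have [e [s [_ _ /associated_colon1/Cass/Hq]]] := associated_point_exists Ch Csat gh nCg.
by case=> t [nt Ct]; apply: nt; rewrite /colon1 mulrA; apply: ideal_mulr; case: Ch.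
Qed.

Lemma point_exists I : homogeneous_ideal I -> ~ saturation I 1 -> exists p, point_of I p.
Proof.
move=> Ih nI1; have [Iid _] := Ih.
have [e [s [_ _ pp]]] := associated_point_exists (saturation_homog Ih)
  (saturation_saturated Iid) (dhomog1 _ _ : (1 : S) \is 0.-homog) nI1.
exists (colon1 (saturation I) (1 * s)); split=> // f If.
by apply: ideal_mulr; [apply: saturation_ideal | apply: saturationW].
Qed.

Definition infinitely_many (T : k -> Prop) := forall s : seq k, exists t, t \notin s /\ T t.

Lemma not_infinitely_many T : ~ infinitely_many T -> exists s : seq k, forall t, T t -> t \in s.
Proof.
move=> /not_all_ex_not[s /not_ex_all_not H]; exists s => t Tt.
by apply/negPn/negP => ts; case: (H t).
Qed.

(* By Noetherian induction: an ideal maximal among those contained in members of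
   [Phi] through infinitely many of the [l t] is prime, hence itself such a member. *)
Lemma infinite_incidence X (Phi : (S -> Prop) -> Prop) (l : k -> S) :
  homogeneous_ideal X -> (forall q, Phi q -> point_of X q) ->
  (forall q p, Phi q -> point_of X p -> subscheme q p -> subscheme p q) ->
  infinitely_many (fun t => exists q, Phi q /\ q (l t)) ->
  exists q, Phi q /\ infinitely_many (fun t => q (l t)).
Proof.
move=> Xh Phip Phimin inf.
pose T I t := exists q, [/\ Phi q, forall f, I f -> q f & q (l t)].
pose Q I := [/\ homogeneous_ideal I, forall f, X f -> I f & infinitely_many (T I)].
have [||M [[Mh XM Minf] Mmax]] := @maximal_ideal_of k Q; first by move=> I [[]].
  exists X; split=> // s; have [t [ts [q [Pq qt]]]] := inf s.
  by exists t; split=> //; exists q; split=> //; have [_] := Phip _ Pq.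
have [_ [_ [q0 [Pq0 Mq0 _]]]] := Minf [::].
have [[q0h q01 q0p [i q0i]] _] := Phip _ Pq0.
have Mp : point M.
  split=> //; [by move/Mq0| |by exists i => /Mq0].
  apply: homog_prime => // d e a b ah bh Mab; apply: NNPP => /not_or_and[nMa nMb].
  have [Mid _] := Mh.
  have small n c : c \is n.-homog -> ~ M c -> exists s : seq k, forall t, T (adj M c) t -> t \in s.
    move=> ch nMc; apply: not_infinitely_many => Tc; apply: nMc.
    apply: (Mmax (adj M c)); last exact: adj_gen; last by move=> f; apply: adjW.
    split=> //; first exact: adj_homog ch.
    by move=> f /XM; apply: adjW.
  have [sa Ha] := small _ _ ah nMa; have [sb Hb] := small _ _ bh nMb.
  have [t []] := Minf (sa ++ sb); rewrite mem_cat negb_or => /andP[ta tb] [q [Pq Mq qt]].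
  have [[[qid _] _ qp _] _] := Phip _ Pq.
  have [qa|qb] := qp _ _ (Mq _ Mab).
    by case/negP: ta; apply: Ha; exists q; split=> //; apply: adj_sub.
  by case/negP: tb; apply: Hb; exists q; split=> //; apply: adj_sub.
exists q0; split=> // s; have [t [ts [q [Pq Mq qt]]]] := Minf s.
exists t; split=> //; apply: Mq0; exact: (Phimin q M Pq).
Qed.

End Points.

Lemma closed_field_avoid (k : closedFieldType) (T : k -> Prop) :
  ~ infinitely_many T -> exists t, ~ T t.
Proof.
move=> /not_infinitely_many[s Ts].
have /closed_nonrootP[t] : \prod_(a <- s) ('X - a%:P) != 0.
  by rewrite prodf_seq_neq0; apply/allP => a _; rewrite polyXsubC_eq0.
by rewrite root_prod_XsubC => nts; exists t => /Ts; apply/negP.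
Qed.

(** * Hilbert functions *)

Section HilbertFunction.
Variable k : fieldType.
Notation S := {mpoly k[4]}.
Implicit Types (V I J K X p q : S -> Prop) (f g h : S).

Definition independent I m (b : 'I_m -> S) : Prop :=
  forall c : 'I_m -> k, I (\sum_i c i *: b i) -> forall i, c i = 0.

Definition spanned V I m (b : 'I_m -> S) : Prop :=
  forall f, V f -> exists c : 'I_m -> k, I (f - \sum_i c i *: b i).

Lemma independent_le I m n (b : 'I_m -> S) (b' : 'I_n -> S) : ideal I ->
  independent I b -> (forall i, exists c : 'I_n -> k, I (b i - \sum_j c j *: b' j)) ->
  (m <= n)%N.
Proof.
move=> Iid bI /choice[c Hc]; rewrite leqNgt; apply/negP => nm.
pose M : 'M[k]_(m, n) := \matrix_(i, j) c i j.
have : kermx M != 0.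
  by rewrite kermx_eq0 /row_free neq_ltn (leq_ltn_trans (rank_leq_col M) nm).
rewrite -nz_row_eq0; set u := nz_row _ => u0.
have uM : u *m M = 0 by apply/sub_kermxP; apply: nz_row_sub.
have u0' : forall i, u 0 i = 0.
  apply: bI; apply: (@ideal_subK _ I _ (\sum_i u 0 i *: \sum_j c i j *: b' j)) => //.
    rewrite -sumrB; apply: ideal_sum => // i _; rewrite -scalerBr.
    by apply: ideal_scale.
  rewrite (_ : \sum_i _ = \sum_j (u *m M) 0 j *: b' j).
    by rewrite uM; apply: ideal_sum => // j _; rewrite mxE scale0r; case: Iid.
  under eq_bigr do rewrite scaler_sumr; rewrite exchange_big; apply: eq_bigr => j _ /=.
  rewrite mxE scaler_suml; apply: eq_bigr => i _; rewrite scalerA mxE.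
  by [].
by case/eqP: u0; apply/rowP => i; rewrite u0' mxE.
Qed.

Lemma independent_extend I m (b : 'I_m -> S) f : ideal I -> independent I b ->
  ~ (exists c : 'I_m -> k, I (f - \sum_i c i *: b i)) ->
  independent I (fun i : 'I_m.+1 => oapp b f (unlift ord0 i)).
Proof.
move=> Iid bI nf c; rewrite big_ord_recl unlift_none /=.
under eq_bigr do rewrite liftK /=.
move=> Ic; have c0 : c ord0 = 0.
  apply/eqP/negPn/negP => c0; apply: nf; exists (fun i => - (c ord0)^-1 * c (lift ord0 i)).
  rewrite (_ : _ - _ = (c ord0)^-1 *: (c ord0 *: f + \sum_(i < m) c (lift ord0 i) *: b i)).
    exact: ideal_scale.
  rewrite scalerDr scalerA mulVf // scale1r -sumrN scaler_sumr; congr (_ + _).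
  by apply: eq_bigr => i _; rewrite scalerA mulNr scaleNr opprK.
move: Ic; rewrite c0 scale0r add0r => /bI ci i.
by case: (unliftP ord0 i) => [j ->|->].
Qed.

Lemma quotient_dim_exists V I n (v : 'I_n -> S) : ideal I -> spanned V I v ->
  exists m, quotient_dim V I m.
Proof.
move=> Iid vs.
have [||m [[b [Vb bI]] mmax]] := @greatest_nat (fun m => exists b : 'I_m -> S,
    (forall i, V (b i)) /\ independent I b) n.+1.
- by exists 0%N, (fun _ => 0); split=> [[]|c _ []].
- move=> m [b [Vb bI]]; rewrite ltnS; apply: (independent_le Iid bI (b' := v)) => i.
  exact: vs.
exists m, b; split=> // f Vf; apply: NNPP => nf; apply: (mmax m.+1) => //.
exists (fun i : 'I_m.+1 => oapp b f (unlift ord0 i)); split; last exact: independent_extend.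
by move=> i; case: (unliftP ord0 i) => [j|] _ /=.
Qed.

Lemma quotient_dim_uniq V I m n : ideal I -> quotient_dim V I m -> quotient_dim V I n -> m = n.
Proof.
move=> Iid [b [Vb bI bs]] [b' [Vb' bI' bs']]; apply/eqP; rewrite eqn_leq.
rewrite (independent_le Iid bI (b' := b')) ?(independent_le Iid bI' (b' := b)) // => i.
  exact: bs.
exact: bs'.
Qed.

Lemma quotient_dim_ext V I J m : (forall f, I f <-> J f) ->
  quotient_dim V I m -> quotient_dim V J m.
Proof.
move=> IJ [b [Vb bI bs]]; exists b; split=> // [c /IJ/bI //|f /bs[c /IJ Hc]].
by exists c.
Qed.

Definition hilb I n : nat :=
  epsilon (inhabits 0%N) (quotient_dim (fun f => f \is n.-homog) I).

Lemma monomials_spanned I n : ideal I -> 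
  spanned (fun f => f \is n.-homog) I
    (fun i : 'I_#|{: 'X_{1..4 < n.+1}}| => 'X_[(enum_val i : 'X_{1..4 < n.+1})]).
Proof.
move=> [I0 _ _] f fh; exists (fun i => f@_((enum_val i : 'X_{1..4 < n.+1}))).
have fn : (msize f <= n.+1)%N.
  case: (eqVneq f 0) => [->|f0]; first by rewrite msize0.
  by rewrite -mlead_deg // ltnS (dhomog_mf fh (mlead_supp f0)).
rewrite {1}(mpolywE fn) (reindex (fun i : 'I_#|{: 'X_{1..4 < n.+1}}| => enum_val i)) ?subrr //=.
by apply: onW_bij; apply: enum_val_bij.
Qed.

Lemma hilbP I n : ideal I -> quotient_dim (fun f => f \is n.-homog) I (hilb I n).
Proof.
move=> Iid; rewrite /hilb; apply: epsilon_spec.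
exact: quotient_dim_exists (monomials_spanned Iid).
Qed.

Lemma hilb_uniq I n m : ideal I -> quotient_dim (fun f => f \is n.-homog) I m -> m = hilb I n.
Proof. by move=> Iid H; apply: quotient_dim_uniq H (hilbP n Iid). Qed.

Lemma eq_hilb_deg I J n : ideal I -> ideal J ->
  (forall f, f \is n.-homog -> I f <-> J f) -> hilb I n = hilb J n.
Proof.
move=> Iid Jid IJ; apply: hilb_uniq => //; have [b [Vb bI bs]] := hilbP n Iid.
exists b; split=> // [c|f fh].
  move=> Jc; apply: bI; apply/IJ => //.
  by apply: rpred_sum => i _; apply: dhomogZ; apply: Vb.
have [c Ic] := bs f fh; exists c; apply/IJ => //.
by apply: rpredB => //; apply: rpred_sum => i _; apply: dhomogZ; apply: Vb.
Qed.

Lemma eq_hilb I J n : ideal I -> ideal J -> (forall f, I f <-> J f) -> hilb I n = hilb J n.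
Proof. by move=> Iid Jid IJ; apply: eq_hilb_deg. Qed.

Lemma hilb_le I J n : ideal I -> ideal J -> (forall f, I f -> J f) -> (hilb J n <= hilb I n)%N.
Proof.
move=> Iid Jid IJ; have [b [Vb bJ _]] := hilbP n Jid; have [b' [_ _ bs']] := hilbP n Iid.
apply: (independent_le (b := b) (b' := b') Iid) => [c /IJ/bJ //|i].
exact: bs'.
Qed.

Lemma hilb_eq_sub I J n : ideal I -> ideal J -> (forall f, I f -> J f) -> hilb I n = hilb J n ->
  forall f, f \is n.-homog -> J f -> I f.
Proof.
move=> Iid Jid IJ E f fh Jf; have [b [Vb bJ _]] := hilbP n Jid.
have bI : independent I b by move=> c /IJ/bJ.
have [b' [_ _ bs']] := hilbP n Iid.
have [c Ic] : exists c : 'I_(hilb J n) -> k, I (f - \sum_i c i *: b i).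
  apply: NNPP => nf; suff : (hilb J n < hilb I n)%N by rewrite E ltnn.
  apply: (independent_le (b' := b') Iid (independent_extend Iid bI nf)) => i.
  by apply: bs'; case: (unliftP ord0 i) => [j|] _ /=.
have c0 : forall i, c i = 0.
  apply: bJ; rewrite -[X in J X](subKr f); apply: ideal_sub => //; exact: IJ.
by move: Ic; rewrite big1 ?subr0 // => i _; rewrite c0 scale0r.
Qed.

Lemma hilb_eq0 I n : ideal I -> (forall f, f \is n.-homog -> I f) -> hilb I n = 0%N.
Proof.
move=> Iid H; apply/esym/hilb_uniq => //; exists (fun _ => 0); split=> [[]|c _ []|f /H If] //.
by exists (fun _ => 0); rewrite big_ord0 subr0.
Qed.

Lemma hilb0_all I n f : ideal I -> hilb I n = 0%N -> f \is n.-homog -> I f.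
Proof.
move=> Iid E fh; have := hilbP n Iid; rewrite E => -[b [_ _ bs]].
by have [c] := bs f fh; rewrite big_ord0 subr0.
Qed.

Lemma hilb_gt0 I n f : ideal I -> f \is n.-homog -> ~ I f -> (0 < hilb I n)%N.
Proof. by move=> Iid fh nf; rewrite lt0n; apply/eqP => /(hilb0_all Iid)/(_ fh). Qed.

(** The exact sequence 0 -> (S / (I : f))(-e) -> S / I -> S / (I + (f)) -> 0: a basis of the middle
    term is made of one of the right term and [f] times one of the left. *)
Lemma hilb_split I e f n : homogeneous_ideal I -> f \is e.-homog ->
  hilb I (n + e) = (hilb (adj I f) (n + e) + hilb (colon1 I f) n)%N.
Proof.
move=> Ih fh; have [Iid Ic] := Ih; apply/esym/hilb_uniq => //.
have [b [Vb bI bs]] := hilbP (n + e) (adj_ideal f Iid).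
have [b' [Vb' bI' bs']] := hilbP n (colon1_ideal f Iid).
pose B (i : 'I_(hilb (adj I f) (n + e) + hilb (colon1 I f) n)) :=
  match split i with inl j => b j | inr j => b' j * f end.
have sumB (c : 'I_(hilb (adj I f) (n + e) + hilb (colon1 I f) n) -> k) :
    \sum_i c i *: B i = \sum_i c (lshift _ i) *: b i + (\sum_i c (rshift _ i) *: b' i) * f.
  rewrite big_split_ord /= mulr_suml; congr (_ + _); apply: eq_bigr => i _; rewrite /B.
    by rewrite -[lshift _ _]/(unsplit (inl i)) unsplitK.
  by rewrite -[rshift _ _]/(unsplit (inr i)) unsplitK scalerAl.
exists B; split=> [i|c|g gh].
- by rewrite /B; case: (split i) => j; [apply: Vb | apply: dhomogM (Vb' j) fh].
- rewrite sumB => H.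
  have c1 : forall i, c (lshift _ i) = 0.
    apply: bI; exists (- \sum_i c (rshift _ i) *: b' i).
    by rewrite mulNr opprK.
  have c2 : forall i, c (rshift _ i) = 0.
    apply: bI'; rewrite /colon1; move: H; rewrite big1 ?add0r // => i _.
    by rewrite c1 scale0r.
  move=> i; rewrite -(splitK i); case: (split i) => j; [exact: c1|exact: c2].
- have [c [u Hu]] := bs g gh.
  have sh : \sum_i c i *: b i \is (n + e).-homog.
    by apply: rpred_sum => i _; apply: dhomogZ; apply: Vb.
  have := Ic _ (n + e)%N Hu; rewrite !raddfB /= (pihomog_dE gh) (pihomog_dE sh).
  rewrite (compMr _ _ fh) leq_addl addnK; set v := pihomog _ _ _ => Hv.
  have [d Hd] := bs' v (pihomogP _ _ _).
  exists (fun i => match split i with inl j => c j | inr j => d j end).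
  rewrite sumB; under eq_bigr do rewrite -[lshift _ _]/(unsplit (inl _)) unsplitK.
  under [X in _ + X * _]eq_bigr do rewrite -[rshift _ _]/(unsplit (inr _)) unsplitK.
  rewrite (_ : _ - _ = (g - \sum_i c i *: b i - v * f) +
    (v - \sum_i d i *: b' i) * f); last by ring.
  by case: Iid => _ ID _; apply: ID.
Qed.

Lemma hilb_adj_lt I e f n : homogeneous_ideal I -> f \is e.-homog -> (n < e)%N ->
  hilb (adj I f) n = hilb I n.
Proof.
move=> Ih fh na; have [Iid _] := Ih; apply: eq_hilb_deg => //; first exact: adj_ideal.
move=> g gh; split; last exact: adjW.
move=> Hg; apply: NNPP => nIg; have [] := adj_witness Ih fh gh Hg nIg.
by rewrite leqNgt na.
Qed.

Definition zero_ideal : S -> Prop := fun f => f = 0.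

Lemma zero_ideal_homog : homogeneous_ideal zero_ideal.
Proof.
split; last by move=> f d ->; apply: raddf0.
by split=> [|f g -> ->|f g ->] //; [apply: addr0 | apply: mulr0].
Qed.

Lemma hilb_zero n : hilb zero_ideal n = 'C(n + 3, 3).
Proof.
have [Zid _] := zero_ideal_homog; apply/esym/hilb_uniq => //.
(* Sorted [n]-tuples of variables, read as multisets, enumerate the monomials of degree [n]. *)
pose s := [seq s2m t | t : n.-tuple 'I_4 <- enum (basis 4 n)].
have sz : size s = 'C(n + 3, 3) by rewrite size_basis -[n in 'C(_, n)](addnK 3) bin_sub ?leq_addl.
have us : uniq s := uniq_basis 4 n.
have ms (m : 'X_{1..4}) : (mdeg m == n) = (m \in s) := basis_cover n m.
pose M (i : 'I_('C(n + 3, 3))) := nth 0%MM s i.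
have big (F : 'X_{1..4} -> S) : \sum_i F (M i) = \sum_(m <- s) F m.
  by rewrite (big_nth 0%MM) big_mkord sz.
exists (fun i => 'X_[M i]); split=> [i|c E i|f fh].
- by rewrite dhomogX /= ms mem_nth ?sz.
- have /(congr1 (mcoeff (M i))) := E; rewrite raddf_sum mcoeff0 /= (bigD1 i) //= big1 => [|j ji].
    by rewrite addr0 mcoeffZ mcoeffX eqxx mulr1.
  rewrite mcoeffZ mcoeffX; case: eqP; last by rewrite mulr0.
  move/eqP; rewrite nth_uniq ?sz // => /eqP/val_inj E'.
  by rewrite E' eqxx in ji.
- exists (fun i => f@_(M i)); rewrite (big (fun m => f@_m *: 'X_[m])).
  apply/eqP; rewrite subr_eq0; apply/eqP/mpolyP => m; rewrite raddf_sum /=.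
  under eq_bigr do rewrite mcoeffZ mcoeffX.
  case: (boolP (m \in s)) => mins.
    rewrite (bigD1_seq m) //= eqxx mulr1 big1 ?addr0 // => m' /negbTE->.
    by rewrite mulr0.
  rewrite (dhomog_nemf_coeff fh) /= ?ms // big_seq big1 // => m' m's.
  by case: eqP => [E|]; rewrite ?mulr0 // -E m's in mins *.
Qed.

End HilbertFunction.

(** * Curves in the plane *)

Section Dimension.
Variable k : fieldType.
Notation S := {mpoly k[4]}.
Implicit Types (I J K X p q : S -> Prop) (f g h : S).

Lemma ideal1 I f : ideal I -> I 1 -> I f.
Proof. by move=> [_ _ IM] I1; rewrite -[f]mulr1; apply: IM. Qed.

Lemma ideal_constant I f : ideal I -> f \is 0.-homog -> f != 0 -> I f -> I 1.
Proof.
move=> Iid fh f0 If; have fC : f = f@_0%MM *: 1.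
  apply/mpolyP => m; rewrite mcoeffZ mcoeff1; case: eqP => [->|/eqP m0]; first by rewrite mulr1.
  by rewrite mulr0 (dhomog_nemf_coeff fh) //= mdeg_eq0.
have c0 : f@_0%MM != 0 by apply: contraNneq f0 => E; rewrite fC E scale0r.
rewrite -[1](scalerK c0) -fC.
exact: ideal_scale.
Qed.

Lemma prime_expr p f n : prime_ideal p -> p (f ^+ n) -> p f.
Proof. by move=> [_ p1 pp]; elim: n => [|n IH]; rewrite ?expr0 ?exprS // => /pp[]. Qed.

Lemma colon1_prime p f g : prime_ideal p -> ~ p f -> colon1 p f g <-> p g.
Proof.
by move=> [pid _ pp] pf; split=> [/pp[]|pg] //; rewrite /colon1; apply: ideal_mulr.
Qed.

Lemma hilb_adj_prime p e f n : homogeneous_ideal p -> prime_ideal p -> f \is e.-homog -> ~ p f ->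
  hilb p (n + e) = (hilb (adj p f) (n + e) + hilb p n)%N.
Proof.
move=> ph pp fh pf; rewrite (hilb_split _ ph fh); congr (_ + _)%N.
have [pid _] := ph; apply: eq_hilb => //; first exact: colon1_ideal.
by move=> g; apply: colon1_prime.
Qed.

Lemma hilb_point_gt0 p n : point p -> (0 < hilb p n)%N.
Proof.
move=> pp; have [[pid _] _ _ [i pi]] := pp; apply: (@hilb_gt0 _ p n ('X_i ^+ n)) => //.
  by have := dhomogMn n (homogX k i); rewrite mul1n.
by move/(prime_expr (point_prime pp)).
Qed.

Lemma notin_comp_homog I J f : homogeneous_ideal J -> ideal I -> J f -> ~ I f ->
  exists d g, [/\ g \is d.-homog, J g & ~ I g].
Proof.
move=> [_ Jc] Iid Jf /(notin_comp Iid)[d nI]; exists d, (pihomog mdeg d f).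
by split=> //; [apply: pihomogP | apply: Jc].
Qed.

(** A form [v] of a strictly larger point that is not in [p] is a nonzerodivisor modulo [p], and the
    quotient by it has positive Hilbert function; so the Hilbert function of [p] grows strictly
    whenever the degree increases by that of [v]. *)
Lemma bounded_hilb_no_chain p B N : point p -> (forall n, (N <= n)%N -> (hilb p n <= B)%N) ->
  ~ has_chain p 1.
Proof.
move=> pp pB [c [cp cs]].
have [[q0p pq0] [q1p pq1]] := (cp 0%N isT, cp 1%N isT).
have [q01 q10] := cs 0%N isT.
have [w [q1w q0w]] : exists w, c 1%N w /\ ~ c 0%N w.
  apply: NNPP => nex; apply: q10 => w q1w; apply: NNPP => q0w; apply: nex.
  by exists w.
have [[pid pc] p1 _ _] := pp; have [q1h _ _ _] := q1p.
have pw : ~ p w by move/pq0.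
have [e [v [vh q1v pv]]] := notin_comp_homog q1h pid q1w pw.
have step n : (hilb p n < hilb p (n + e))%N.
  rewrite (hilb_adj_prime _ _ (point_prime pp) vh pv) // addnC -[X in (X < _)%N]addn0 ltn_add2l.
  apply: leq_trans (hilb_point_gt0 (n + e) q1p) _; apply: hilb_le => //.
  - exact: adj_ideal.
  - by case: q1h.
  - by move=> f; apply: adj_sub => //; case: q1h.
have grow j : (j <= hilb p (N + j * e))%N.
  elim: j => // j IH; rewrite mulSn [(e + _)%N]addnC addnA.
  by apply: leq_ltn_trans IH (step _).
have := leq_trans (grow B.+1) (pB (N + B.+1 * e)%N (leq_addr _ _)).
by rewrite ltnn.
Qed.

End Dimension.

Lemma bin_double n : ('C(n + 2, 2) * 2 = (n + 2) * (n + 1))%N.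
Proof. by rewrite addn2 addn1 mulnC -mul_bin_diag bin1. Qed.

Section PlaneCurves.
Variables (k : fieldType) (h : {mpoly k[4]}).
Hypotheses (h_linear : h \is 1.-homog) (h_neq0 : h != 0).
Notation S := {mpoly k[4]}.
Notation H := (principal h).
Implicit Types (I J K X p q : S -> Prop) (f g : S).

Let Hid : ideal H := principal_ideal h.
Let Hh : homogeneous_ideal H := principal_homog h_linear.
Let Hp : prime_ideal H := plane_prime h_linear h_neq0.

Lemma hilb_plane n : hilb H n = 'C(n + 2, 2).
Proof.
have [Zid _] := zero_ideal_homog k.
have E : hilb H n = hilb (adj (@zero_ideal k) h) n.
  apply: eq_hilb => //; first exact: adj_ideal.
  move=> f; split=> -[c fE]; exists c; first by rewrite fE /zero_ideal subrr.
  by apply/eqP; rewrite -subr_eq0; apply/eqP.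
rewrite E; case: n {E} => [|n].
  by rewrite (hilb_adj_lt (zero_ideal_homog k) h_linear) // hilb_zero.
have Zp : prime_ideal (@zero_ideal k).
  split=> // [|f g /eqP]; first by move/eqP; rewrite oner_eq0.
  by rewrite mulf_eq0 => /orP[]/eqP; [left|right].
have := hilb_adj_prime n (zero_ideal_homog k) Zp h_linear (elimN eqP h_neq0).
by rewrite !hilb_zero addn1 !addn3 addn2 (binS n.+3 2) => E; lia.
Qed.

Lemma hilb_plane_curve d f n : f \is d.-homog -> ~ H f ->
  (hilb (adj H f) (n + d) + 'C(n + 2, 2) = 'C(n + d + 2, 2))%N.
Proof. by move=> fh nf; rewrite -!hilb_plane -(hilb_adj_prime _ Hh Hp fh nf). Qed.

(** Bezout's theorem: the Hilbert function is the mixed second difference, with shifts [d] and [e],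
    of the quadratic ['C(n + 2, 2)]. *)
Lemma hilb_plane_complete_intersection d e f g n : f \is d.-homog -> ~ H f ->
  prime_ideal (adj H f) -> g \is e.-homog -> ~ adj H f g ->
  hilb (adj (adj H f) g) (n + d + e) = (d * e)%N.
Proof.
move=> fh nf Kp gh ng; have Kh := adj_homog Hh fh.
have := hilb_adj_prime (n + d) Kh Kp gh ng.
have := hilb_plane_curve n fh nf; have := hilb_plane_curve (n + e) fh nf.
rewrite (_ : n + e + d = n + d + e)%N; last by rewrite addnAC.
have := bin_double n; have := bin_double (n + d); have := bin_double (n + e).
have := bin_double (n + d + e).
move: (hilb _ _) (hilb _ _) (hilb _ _) => x y z.
move: 'C(_, _) 'C(_, _) 'C(_, _) 'C(_, _) => c1 c2 c3 c4 E1 E2 E3 E4 E5 E6 E7.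
nia.
Qed.

Lemma plane_point_no_chain p d e f g : point p -> p h -> p f -> p g ->
  f \is d.-homog -> ~ H f -> prime_ideal (adj H f) -> g \is e.-homog -> ~ adj H f g ->
  ~ has_chain p 1.
Proof.
move=> pp ph pf pg fh nf Kp gh ng; have [[pid _] _ _ _] := pp.
apply: (@bounded_hilb_no_chain _ p (d * e) (d + e)) => // n len.
rewrite -(hilb_plane_complete_intersection (n - (d + e)) fh nf Kp gh ng) -addnA subnK //.
apply: hilb_le => //; first by do 2!apply: adj_ideal.
by do 2!apply: adj_sub => //; apply: principal_sub.
Qed.

(** [D] is a common divisor modulo [h] of the elements of [I], of maximal degree. If it were not in
    [I], some associated prime of [I : D], which is also one of [I], would contain a prime form [pi]
    and a form not divisible by it modulo [h]; by Bezout it would admit no chain. *)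
Lemma plane_curve_principal I : homogeneous_ideal I -> saturated I -> I h ->
  (exists g, I g /\ ~ H g) -> (forall p, associated_point I p -> has_chain p 1) ->
  exists d f, [/\ f \is d.-homog, ~ H f & forall g, I g <-> adj H f g].
Proof.
move=> Ih Isat Ihh [g1 [Ig1 nHg1]] Iass; have [Iid Ic] := Ih.
have [n [g0 [g0h Ig0 nHg0]]] := notin_comp_homog Ih Hid Ig1 nHg1.
have HI := principal_sub Iid Ihh; have [_ HD HM] := Hid.
have [||d [[D [Dh ID]] dmax]] := @greatest_nat
    (fun d => exists D, D \is d.-homog /\ forall g, I g -> adj H D g) n.+1.
- exists 0%N, 1; split; first exact: dhomog1.
  by move=> g _; apply: ideal1; [apply: adj_ideal | apply: adj_gen].
- move=> d [D [Dh ID]]; rewrite ltnS.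
  by have [] := adj_witness Hh Dh g0h (ID _ Ig0) nHg0.
have nHD : ~ H D.
  by move=> HDD; apply: nHg0; apply: (adj_sub Hid) (ID _ Ig0).
exists d, D; split=> // g; split; first exact: ID.
apply: adj_sub => //; apply: NNPP => nID.
have Jh : homogeneous_ideal (colon1 I D) := colon1_homog Ih Dh.
have [Jid Jc] := Jh.
have nJ1 : ~ colon1 I D 1 by rewrite /colon1 mul1r.
have [e [s [sh _ pp]]] := associated_point_exists Jh (colon1_saturated Isat)
  (dhomog1 _ _ : (1 : S) \is 0.-homog) nJ1.
set p := colon1 _ _ in pp; have Jp f : colon1 I D f -> p f by move=> Jf; apply: ideal_mulr.
have [pid _] := (point_prime pp).
have IJ f : I f -> colon1 I D f by move=> If; apply: ideal_mulr.
have pchain : has_chain p 1.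
  apply: Iass; split=> //; exists (1 * s * D) => f.
  by rewrite /p /colon1 -[f * _ * D]mulrA.
have [dn [c [ch Hc]]] := adj_witness Hh Dh g0h (ID _ Ig0) nHg0.
have nHc : ~ H c.
  by move=> Hc'; apply: nHg0; apply: (ideal_subK Hid Hc); apply: ideal_mulr.
have Jc' : colon1 I D c.
  rewrite /colon1 -(subKr g0 (c * D)); apply: ideal_sub => //; exact: HI.
have ph : p h by apply: Jp; apply: IJ.
have [m [pi [pih ppi nHpi Kp Kc]]] := plane_homog_prime_factor h_linear h_neq0 ch nHc
  (point_prime pp) ph (Jp _ Jc').
have m_gt0 : (0 < m)%N.
  rewrite lt0n; apply/eqP => m0; have [_ p1 _] := point_prime pp; apply: p1.
  apply: (ideal_constant pid _ _ ppi); first by rewrite m0 in pih.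
  by apply/eqP => pi0; apply: nHpi; rewrite pi0; case: Hid.
(* If [pi] divided every element of [I : D] modulo [h], then [pi * D] would be a common divisor of
   larger degree. *)
have [u [Ju Ku]] : exists u, colon1 I D u /\ ~ adj H pi u.
  apply: NNPP => nex; apply: (dmax (m + d)%N); first by rewrite -[X in (X < _)%N]add0n ltn_add2r.
  exists (pi * D); split; first exact: dhomogM.
  move=> f If; have [b Hb] := ID f If.
  have [a Ha] : adj H pi b.
    apply: NNPP => nK; apply: nex; exists b; split=> //.
    by rewrite /colon1 -(subKr f (b * D)); apply: ideal_sub => //; apply: HI.
  exists a; rewrite (_ : _ - _ = (f - b * D) + D * (b - a * pi)); last by ring.
  by apply: HD => //; apply: HM.
have [r [{}u [uh {}Ju {}Ku]]] := notin_comp_homog Jh (adj_ideal pi Hid) Ju Ku.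
by case: (plane_point_no_chain pp ph ppi (Jp _ Ju) pih nHpi Kp uh Ku).
Qed.

Lemma hilb_saturation1 I : homogeneous_ideal I -> saturation I 1 ->
  exists N, forall n, (N <= n)%N -> hilb I n = 0%N.
Proof.
move=> [Iid _] /(saturationP Iid)[N HN]; exists N => n Nn; apply: hilb_eq0 => // f fh.
by rewrite -[f]mulr1; apply: HN fh.
Qed.

Lemma linear_notin p : ideal p -> ~ saturation p 1 -> exists i, ~ p 'X_i.
Proof.
move=> pid np1; apply: NNPP => nex; apply: np1; exists 1%N => m /eqP/mdeg1P[i /eqP->].
by rewrite mulr1; apply: NNPP => nX; apply: nex; exists i.
Qed.

(** This excludes that P is the whole plane. The chain consists of the plane, an integral curve and
    a point; each exists because otherwise a Hilbert function would vanish in large degrees, against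
    the counts above. *)
Lemma plane_not_dimension1 : ~ dimension H 1.
Proof.
case=> _; apply.
have [i Hi] : exists i, ~ H 'X_i.
  apply: linear_notin => //; move/(hilb_saturation1 Hh) => [N /(_ _ (leqnn N))].
  rewrite hilb_plane => E; have := bin_double N; rewrite E; lia.
have c1 : ~ saturation (adj H 'X_i) 1.
  move/(hilb_saturation1 (adj_homog Hh (homogX k i))) => [N /(_ (N + 1)%N (leq_addr _ _)) E].
  have := hilb_plane_curve N (homogX k i) Hi; rewrite E.
  have := bin_double N; have := bin_double (N + 1); nia.
have [p0 [p0p Xp0]] := point_exists (adj_homog Hh (homogX k i)) c1.
have p0h : p0 h by apply: Xp0; apply: adjW => //; exists 1; rewrite mul1r.
have p0X : p0 'X_i by apply: Xp0; apply: adj_gen.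
have [d [pi [pih p0pi nHpi Kp Ki]]] := plane_homog_prime_factor h_linear h_neq0
  (homogX k i) Hi (point_prime p0p) p0h p0X.
have Kh := adj_homog Hh pih; have [Kid _] := Kh.
have d_gt0 : (0 < d)%N.
  rewrite lt0n; apply/eqP => d0; have [pid p1 _] := point_prime p0p; apply: p1.
  apply: (ideal_constant pid _ _ p0pi); first by rewrite d0 in pih.
  by apply/eqP => pi0; apply: nHpi; rewrite pi0; case: Hid.
have Kpoint : point (adj H pi).
  have [_ K1 Kpr] := Kp; split=> //; apply: linear_notin => //.
  move/(hilb_saturation1 Kh) => [N /(_ (N + d)%N (leq_addr _ _)) E].
  have := hilb_plane_curve N pih nHpi; rewrite E.
  have := bin_double N; have := bin_double (N + d); nia.
have [j Kj] : exists j, ~ adj H pi 'X_j by case: Kpoint.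
have Lh := adj_homog Kh (homogX k j).
have c2 : ~ saturation (adj (adj H pi) 'X_j) 1.
  move/(hilb_saturation1 Lh) => [N /(_ (N + d + 1)%N)].
  rewrite (hilb_plane_complete_intersection N pih nHpi Kp (homogX k j) Kj) => E.
  by have := E (leq_trans (leq_addr _ _) (leq_addr _ _)); lia.
have [p2 [p2p Xp2]] := point_exists Lh c2.
pose c n := if n is 0%N then H else if n is 1%N then adj H pi else p2.
have HK f : H f -> adj H pi f by apply: adjW.
have Kp2 f : adj H pi f -> p2 f by move=> Kf; apply: Xp2; apply: adjW.
exists c; split=> [[|[|[|//]]]|[|[|//]]] _ /=.
- by split=> //; have [_ H1 Hpr] := Hp; split=> //; exists i.
- by split.
- by split=> // f /HK/Kp2.
- by split=> // HKs; apply: nHpi; apply: HKs; apply: adj_gen.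
- by split=> // Ks; apply: Kj; apply: Ks; apply: Xp2; apply: adj_gen.
Qed.

End PlaneCurves.

(** * Zero-dimensional schemes *)

Section ZeroDimensional.
Variable k : closedFieldType.
Notation S := {mpoly k[4]}.
Implicit Types (I J K X Z p q : S -> Prop) (f g h l : S).

Lemma infinitely_many_uniq (T : k -> Prop) n : infinitely_many T ->
  exists t : 'I_n -> k, injective t /\ forall i, T (t i).
Proof.
move=> inf; have [s [us sz sT]] : exists s : seq k,
    [/\ uniq s, size s = n & forall x, x \in s -> T x].
  elim: n => [|n [s [us sz sT]]]; first by exists [::].
  have [t [ts Tt]] := inf s; exists (t :: s); rewrite /= ts us sz; split=> // x.
  by rewrite inE => /orP[/eqP->|/sT].
exists (fun i : 'I_n => s`_i); split=> [i j /eqP|i]; last by apply: sT; rewrite mem_nth ?sz.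
by rewrite nth_uniq ?sz // => /eqP/val_inj.
Qed.

(** Any [n] distinct parameters give an invertible Vandermonde matrix, whose inverse recovers each
    [v i] from the members of the family. *)
Lemma moment_curve I n (v : 'I_n -> S) : ideal I ->
  infinitely_many (fun t => I (\sum_(i < n) t ^+ i *: v i)) -> forall i, I (v i).
Proof.
move=> Iid /(infinitely_many_uniq n)[t [tinj It]] i.
pose V := Vandermonde n (\row_j t j).
have Vu : V \in unitmx.
  rewrite unitmxE det_Vandermonde unitfE; apply/prodf_neq0 => a _.
  apply/prodf_neq0 => b ab; rewrite !mxE subr_eq0; apply/eqP => /tinj E.
  by rewrite E ltnn in ab.
suff -> : v i = \sum_j invmx V j i *: \sum_(a < n) t j ^+ a *: v a.
  by apply: ideal_sum => // j _; apply: ideal_scale.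
have VK (a : 'I_n) : \sum_j t j ^+ a * invmx V j i = (a == i)%:R.
  have := congr1 (fun M : 'M[k]_n => M a i) (mulmxV Vu); rewrite mxE [RHS]mxE => <-.
  by apply: eq_bigr => j _; rewrite !mxE.
under eq_bigr do rewrite scaler_sumr; rewrite exchange_big /=.
have {}VK (a : 'I_n) : \sum_j invmx V j i *: (t j ^+ a *: v a) = (a == i)%:R *: v a.
  by rewrite -VK scaler_suml; apply: eq_bigr => j _; rewrite scalerA mulrC.
under eq_bigr do rewrite VK.
rewrite (bigD1 i) //= eqxx scale1r big1 ?addr0 // => a /negbTE->.
by rewrite scale0r.
Qed.

Lemma zero_dim_maximal Z p q : zero_dimensional Z -> point_of Z q -> point_of Z p ->
  subscheme q p -> subscheme p q.
Proof.
move=> [_ nch] Zq Zp pq; apply: NNPP => nqp; apply: nch.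
exists (fun n => if n is 0%N then p else q); split=> [[|[|//]] _ //|[|//] _].
by split.
Qed.

(** The points of Z are pairwise incomparable, so [infinite_incidence] applies to the family [l t]:
    were infinitely many members bad, one point would contain infinitely many of them, hence all
    variables. *)
Lemma linear_form_off Z : zero_dimensional Z ->
  exists l, l \is 1.-homog /\ forall p, point_of Z p -> ~ p l.
Proof.
move=> Z0; have [[Zh _] _] := Z0.
pose l (t : k) : S := \sum_(i < 4) t ^+ i *: 'X_i.
have lh t : l t \is 1.-homog.
  by apply: rpred_sum => i _; apply: dhomogZ; apply: homogX.
have [|t nt] := @closed_field_avoid k (fun t => exists q, point_of Z q /\ q (l t)).
  move=> inf; have [||q [[qp Zq] Hq]] := infinite_incidence Zh _ _ inf => //.
    by move=> q p Zq Zp; apply: zero_dim_maximal Z0 Zq Zp.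
  have [[qid _] _ _ [i nqi]] := qp; apply: nqi.
  exact: (@moment_curve q 4 (fun i => 'X_i)).
by exists (l t); split=> // p Zp pl; apply: nt; exists p.
Qed.

Variables (Z : S -> Prop) (l : S).
Hypotheses (Zh : homogeneous_ideal Z) (Zsat : saturated Z) (lh : l \is 1.-homog).
Hypothesis l_off : forall p, point_of Z p -> ~ p l.

Let Zid : ideal Z := Zh.1.

(** Adding [l] to the ideal of Z leaves no point, so its saturation is the unit ideal:
    multiplication by [l] is onto in large degrees of S / Z. *)
Lemma off_surjective : exists N, forall n g, (N <= n)%N -> g \is n.-homog -> adj Z l g.
Proof.
have sat1 : saturation (adj Z l) 1.
  apply: NNPP => /(point_exists (adj_homog Zh lh))[p [pp Zp]].
  apply: (l_off (p := p)); last by apply: Zp; apply: adj_gen.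
  by split=> // f Zf; apply: Zp; apply: adjW.
have [N HN] := saturationP (adj_ideal l Zid) sat1; exists N => n g Nn gh.
by rewrite -[g]mulr1; apply: HN gh.
Qed.

Lemma off_nonzerodivisor n g : g \is n.-homog -> Z (l * g) -> Z g.
Proof.
move=> gh; apply: nonzerodivisor gh => // p pass; apply: l_off.
have [pp [f pf]] := pass; split=> // g' Zg'; apply/pf; exact: ideal_mulr.
Qed.

Lemma off_nonzerodivisor_expr n g j : g \is n.-homog -> Z (l ^+ j * g) -> Z g.
Proof.
move=> gh; elim: j => [|j IH]; first by rewrite mul1r.
rewrite exprS -mulrA => H; apply: IH; apply: (@off_nonzerodivisor (j + n)) => //.
by apply: dhomogM gh; have := dhomogMn j lh; rewrite mul1n.
Qed.

Let W := adj Z (l - 1).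
Let Wid : ideal W := adj_ideal _ Zid.

(** Write [g] as [u * (l - 1)] modulo Z and compare degrees: the components of [u] below [n] vanish,
    the one in degree [n] is [- g], and the later ones are its multiples by powers of [l]. As [u]
    has finitely many components, some power of [l] kills [g], and [l] is a nonzerodivisor on
    forms. *)
Lemma dehomogenize_injective n g : g \is n.-homog -> W g -> Z g.
Proof.
move=> gh [u Hu]; have [_ Zc] := Zh; have [_ ZD ZM] := Zid.
have comp_u d : Z ((if n == d then g else 0) -
    ((if (1 <= d)%N then pihomog mdeg (d - 1) u * l else 0) - pihomog mdeg d u)).
  have := Zc _ d Hu; rewrite mulrBr mulr1 !raddfB /= (compMr _ _ lh) (compE _ gh).
  by [].
have below d : (d < n)%N -> Z (pihomog mdeg d u).
  elim: d => [|d IH] dn; have := comp_u; [move/(_ 0%N)|move/(_ d.+1)].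
    by rewrite (gtn_eqF dn) sub0r sub0r opprK.
  rewrite (gtn_eqF dn) subn1 /= sub0r opprB => H; apply: (ideal_subK Zid H).
  by apply: ideal_mulr => //; apply: IH; apply: ltnW.
have gu : Z (g + pihomog mdeg n u).
  have := comp_u n; rewrite eqxx opprB addrA; case: (posnP n) => [->|n0]; first by rewrite subr0.
  move=> H; apply: (ideal_subK Zid H); apply: ideal_mulr => //; apply: below; lia.
have above j : Z (pihomog mdeg (n + j) u - l ^+ j * pihomog mdeg n u).
  elim: j => [|j IH]; first by rewrite addn0 mul1r subrr; case: Zid.
  have := comp_u (n + j.+1)%N; rewrite addnS (ltn_eqF (_ : n < (n + j).+1)%N) ?ltnS ?leq_addr //.
  rewrite subn1 /= sub0r opprB => H.
  rewrite (_ : _ - _ = (pihomog mdeg (n + j).+1 u - pihomog mdeg (n + j) u * l) +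
    l * (pihomog mdeg (n + j) u - l ^+ j * pihomog mdeg n u)); last by rewrite exprS; ring.
  by apply: ZD => //; apply: ZM.
apply: (ideal_subK Zid (g := - pihomog mdeg n u)); first by rewrite opprK.
apply: ideal_opp => //; apply: (off_nonzerodivisor_expr (j := msize u)) (pihomogP _ _ _) _.
have := above (msize u); rewrite comp_bound ?leq_addl // sub0r => /(ideal_opp Zid).
by rewrite opprK.
Qed.

(** Since [l] becomes 1, components of low degree are raised to degree [n] by powers of [l], and
    those of high degree are lowered by dividing by [l] modulo Z. *)
Lemma dehomogenize_surjective n f : (forall d g, (n <= d)%N -> g \is d.-homog -> adj Z l g) ->
  exists g, g \is n.-homog /\ W (f - g).
Proof.
move=> Hn; have [W0 WD WM] := Wid; have Wl c : W (c * l - c).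
  by exists c; rewrite mulrBr mulr1 subrr; case: Zid.
have homd d : forall g, g \is d.-homog -> exists g', g' \is n.-homog /\ W (g - g').
  case: (leqP d n) => [dn|nd].
    move=> g gh; exists (g * l ^+ (n - d)); split.
      have := dhomogM gh (dhomogMn (n - d) lh); by rewrite mul1n subnKC.
    elim: (n - d)%N => [|j IH]; first by rewrite mulr1 subrr.
    rewrite (_ : _ - _ = (g - g * l ^+ j) - ((g * l ^+ j) * l - g * l ^+ j)).
      exact: ideal_sub.
    by rewrite exprS; ring.
  rewrite -(subnK nd); elim: (d - n.+1)%N => [|e IH] g gh.
  - have [c Hc] := Hn _ _ (leqnSn n) gh.
    have := Zh.2 _ n.+1 Hc; rewrite raddfB /= (pihomog_dE gh) (compMr _ _ lh) subn1 /= => H.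
    exists (pihomog mdeg n c); split; first exact: pihomogP.
    rewrite -(subrKA (pihomog mdeg n c * l)); apply: (WD) => //; exact: adjW.
  - have [c Hc] := Hn _ _ (leq_trans (leqnSn n) (leq_addl _ _)) gh.
    have := Zh.2 _ (e.+1 + n.+1)%N Hc; rewrite raddfB /= (pihomog_dE gh) (compMr _ _ lh).
    rewrite addSn subn1 /= => H.
    have [g' [g'h Wg']] := IH _ (pihomogP _ _ c); exists g'; split=> //.
    rewrite -(subrKA (pihomog mdeg (e + n.+1) c)); apply: (WD) => //.
    rewrite -(subrKA (pihomog mdeg (e + n.+1) c * l)); apply: (WD) => //; exact: adjW.
rewrite (comp_sum (leqnn (msize f))).
elim/big_ind: _ => [|a b [a' [ah Wa]] [b' [bh Wb]]|i _].
- by exists 0; rewrite subrr; split=> //; apply: dhomog0.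
- by exists (a' + b'); rewrite opprD addrACA; split; [apply: dhomogD | apply: (WD)].
- exact: homd (pihomogP _ _ _).
Qed.

Lemma off_length : exists N, forall n, (N <= n)%N ->
  quotient_dim (fun=> True) (ideal_add Z (principal (l - 1))) (hilb Z n).
Proof.
have [N HN] := off_surjective; exists N => n Nn.
apply: (@quotient_dim_ext _ _ W) => [f|].
  split=> [[c Hc]|[a [_ [Za [c ->] ->]]]]; last by exists c; rewrite addrK.
  by exists (f - c * (l - 1)), (c * (l - 1)); rewrite subrK; split=> //; exists c.
have [b [bh bZ bs]] := hilbP n Zid; exists b; split=> // [c Wc|f _].
  apply: bZ; apply: dehomogenize_injective Wc.
  by apply: rpred_sum => i _; apply: dhomogZ; apply: bh.
have [d g nd|g [gh Wg]] := @dehomogenize_surjective n f.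
  by apply: HN; apply: leq_trans nd.
have [c Zc] := bs g gh; exists c; rewrite -(subrKA g).
by have [_ WD _] := Wid; apply: (WD) => //; apply: adjW.
Qed.

End ZeroDimensional.

Section Length.
Variable k : closedFieldType.
Notation S := {mpoly k[4]}.

(** The length is chosen through an unspecified linear form; for any such form [off_length]
    identifies it with the Hilbert function in large degrees, so the choice is immaterial. *)
Lemma scheme_length_hilb (Z : S -> Prop) : zero_dimensional Z ->
  exists N, forall n, (N <= n)%N -> hilb Z n = scheme_length Z.
Proof.
move=> Z0; have [[Zh Zsat] _] := Z0.
have Zlen : is_length Z (scheme_length Z).
  rewrite /scheme_length; apply: epsilon_spec.
  have [l [lh l_off]] := linear_form_off Z0.
  have [N HN] := off_length Zh Zsat lh l_off.
  by exists (hilb Z N), l; split=> //; apply: HN.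
have [l [lh l_off Hl]] := Zlen; have [N HN] := off_length Zh Zsat lh l_off.
exists N => n Nn; apply: quotient_dim_uniq (HN n Nn) Hl.
split.
- by exists 0, 0; rewrite addr0; split=> //; [case: Zh => -[] | exists 0; rewrite mul0r].
- move=> _ _ [a [_ [Za [c ->] ->]]] [b [_ [Zb [d ->] ->]]].
  exists (a + b), ((c + d) * (l - 1)); rewrite mulrDl addrACA; split=> //.
    by case: Zh => -[_ ZD _] _; apply: ZD.
  by exists (c + d); rewrite mulrDl.
- move=> f _ [a [_ [Za [c ->] ->]]]; exists (f * a), (f * c * (l - 1)).
  split; [|by exists (f * c)|by rewrite -mulrA -mulrDr].
  by case: Zh => -[_ _ ZM] _; apply: ZM.
Qed.

(** Multiplication by [f / l] is an endomorphism of the degree [N] part of S / p. It has an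
    eigenvalue [a] because [k] is algebraically closed, and for an eigenvector [g] the product
    [(f - a *: l) * g] lies in [p] while [g] does not. *)
Lemma point_coordinates (p : S -> Prop) (l : S) N : point p ->
  (forall g, g \is N.+1.-homog -> exists c, c \is N.-homog /\ p (g - c * l)) ->
  forall f, f \is 1.-homog -> exists a, p (f - a *: l).
Proof.
move=> pp Hl f fh; have [pid p1 pprime] := point_prime pp.
have [b [bh bp bs]] := hilbP N pid; have m0 := hilb_point_gt0 N pp.
have /choice[c Hc] : forall j, exists c, c \is N.-homog /\ p (f * b j - c * l).
  by move=> j; apply: Hl; have := dhomogM fh (bh j); rewrite add1n.
have /choice[M HM] : forall j, exists d : 'I_(hilb p N) -> k, p (c j - \sum_i d i *: b i).
  by move=> j; apply: bs; have [] := Hc j.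
pose A : 'M[k]_(hilb p N) := \matrix_(i, j) M i j.
have /closed_rootP[a] : size (char_poly A) != 1%N.
  by rewrite size_char_poly; case: (hilb p N) m0.
rewrite -eigenvalue_root_char => /eigenvalueP[v vA v0].
exists a; pose g := \sum_j v 0 j *: b j.
have ng : ~ p g.
  by move/bp => E; case/eqP: v0; apply/rowP => j; rewrite E mxE.
suff /pprime[] : p ((f - a *: l) * g) by [].
have vc : p (\sum_j v 0 j *: c j - a *: g).
  rewrite (_ : a *: g = \sum_j v 0 j *: \sum_i M j i *: b i).
    rewrite -sumrB; apply: ideal_sum => // j _; rewrite -scalerBr; exact: ideal_scale.
  under [RHS]eq_bigr do rewrite scaler_sumr.
  rewrite exchange_big scaler_sumr; apply: eq_bigr => i _ /=.
  rewrite scalerA; have := congr1 (fun w : 'rV_(hilb p N) => w 0 i) vA; rewrite !mxE => <-.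
  by rewrite scaler_suml; apply: eq_bigr => j _; rewrite mxE scalerA.
rewrite (_ : _ * g = (f * g - (\sum_j v 0 j *: c j) * l) +
    l * (\sum_j v 0 j *: c j - a *: g)); last first.
  by rewrite mulrBl mulrBr -scalerAl -scalerAr; ring.
have [_ pD pM] := pid; apply: pD; last exact: pM.
rewrite /g mulr_sumr mulr_suml -sumrB; apply: ideal_sum => // j _.
rewrite -scalerAr -scalerAl -scalerBr; apply: ideal_scale => //.
by have [] := Hc j.
Qed.

End Length.

Lemma predicate_ext (T : Type) (A B : T -> Prop) : (forall x, A x <-> B x) -> A = B.
Proof.
move=> AB; apply: functional_extensionality => x; exact: propositional_extensionality.
Qed.

Section PlaneCurveIdeal.
Variables (k : closedFieldType) (h : {mpoly k[4]}).
Notation S := {mpoly k[4]}.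
Notation H := (principal h).
Hypotheses (h_linear : h \is 1.-homog) (h_neq0 : h != 0).

Let Hid : ideal H := principal_ideal h.
Let Hh : homogeneous_ideal H := principal_homog h_linear.
Let Hp : prime_ideal H := plane_prime h_linear h_neq0.

Lemma has_chain_sub (X X' : S -> Prop) r : (forall f, X f -> X' f) ->
  has_chain X' r -> has_chain X r.
Proof.
move=> XX' [c [cp cs]]; exists c; split=> // i ir; have [pp X'c] := cp i ir.
by split=> // f /XX'/X'c.
Qed.

Lemma plane_curve_ideal (P : S -> Prop) : curve P -> subscheme P H ->
  exists d f, [/\ (0 < d)%N, f \is d.-homog, ~ H f & P = adj H f].
Proof.
move=> [[Ph Psat] P1 Pgen Pass] PH; have [Pid _] := Ph.
have Phh : P h by apply: PH; exists 1; rewrite mul1r.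
have exg : exists g, P g /\ ~ H g.
  apply: NNPP => nex; have PE : P = H.
    apply: predicate_ext => f; split=> [Pf|/PH //].
    by apply: NNPP => nHf; apply: nex; exists f.
  apply: (plane_not_dimension1 h_linear h_neq0); rewrite -PE; apply: Pgen.
  split=> [|q [_ Pq] _ //]; split=> //; split=> //.
    by rewrite PE; have [] := Hp.
  by apply: linear_notin => // /Psat.
have [|d [f [fh nHf PE]]] := plane_curve_principal h_linear h_neq0 Ph Psat Phh exg.
  by move=> p /Pass/Pgen[].
have {}PE := predicate_ext PE; exists d, f; split=> //.
rewrite lt0n; apply/eqP => d0; apply: P1; rewrite d0 in fh.
apply: (ideal_constant Pid fh); last by rewrite PE; apply: adj_gen.
by apply/eqP => f0; apply: nHf; rewrite f0; case: Hid.
Qed.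

End PlaneCurveIdeal.

(** * Local generators *)

Section Nakayama.
Variable k : fieldType.
Notation S := {mpoly k[4]}.
Implicit Types (I J Q p : S -> Prop) (f g : S) (gs : seq S).

(** The recursive form lets the head generator be eliminated through a single coefficient. *)
Fixpoint span_ideal gs : S -> Prop :=
  if gs is g :: gs' then adj (span_ideal gs') g else @zero_ideal k.

Lemma span_ideal_ideal gs : ideal (span_ideal gs).
Proof.
by elim: gs => [|g gs IH] /=; [case: (zero_ideal_homog k) | apply: adj_ideal].
Qed.

Lemma span_ideal_gen gs g : g \in gs -> span_ideal gs g.
Proof.
elim: gs => [//|g' gs IH]; rewrite inE => /orP[/eqP->|/IH Hg] /=.
  by apply: adj_gen; apply: span_ideal_ideal.
by apply: adjW => //; apply: span_ideal_ideal.
Qed.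

Lemma span_ideal_sub gs J : ideal J -> (forall g, g \in gs -> J g) ->
  forall f, span_ideal gs f -> J f.
Proof.
move=> Jid; elim: gs => [|g gs IH] Jgs /=; first by move=> f ->; case: Jid.
apply: adj_sub => //; last by apply: Jgs; rewrite inE eqxx.
by apply: IH => a ags; apply: Jgs; rewrite inE ags orbT.
Qed.

(* Eliminating one generator at a time replaces the determinant trick. *)
Lemma local_nakayama p x Q gs : prime_ideal p -> p x -> ideal Q ->
  (forall g, g \in gs -> exists s w, [/\ ~ p s, span_ideal gs w & Q (s * g - x * w)]) ->
  exists t, ~ p t /\ forall g, g \in gs -> Q (t * g).
Proof.
move=> [pid p1 pp] px Qid; have [_ QD QM] := Qid; elim: gs => [|g gs IH] Hgs.
  by exists 1.
have [|s [w [ps [c Hc] Qsw]]] := Hgs g; first by rewrite inE eqxx.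
set w' := w - c * g in Hc; pose t0 := s - x * c.
(* Because [x] is in [p], [t0] stays outside [p], and [g] is expressed locally, modulo [Q], by the
   remaining generators. *)
have pt0 : ~ p t0.
  by move=> pt; apply: ps; apply: (ideal_subK pid pt); apply: ideal_mulr.
have Qt0 : Q (t0 * g - x * w').
  by rewrite (_ : _ - _ = s * g - x * w) // /t0 /w'; ring.
have [_ sD sM] := span_ideal_ideal gs.
have [g' g'gs|t [pt Ht]] := IH.
  have [|s' [w2 [ps' [c2 Hc2] Q2]]] := Hgs g'; first by rewrite inE g'gs orbT.
  exists (t0 * s'), (c2 * (x * w') + t0 * (w2 - c2 * g)); split.
  - by move/pp => [].
  - by apply: (sD); apply: (sM) => //; apply: (sM).
  - rewrite (_ : _ - _ = t0 * (s' * g' - x * w2) + x * c2 * (t0 * g - x * w')); last by ring.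
    by apply: (QD); apply: (QM).
have Qtw : Q (w' * t).
  apply: (span_ideal_sub (colon1_ideal t Qid) _ Hc) => a /Ht.
  by rewrite /colon1 mulrC.
exists (t * t0); split; first by move/pp => [].
move=> a; rewrite inE => /orP[/eqP->|/Ht Qa]; last first.
  by rewrite mulrAC mulrC; apply: (QM).
rewrite (_ : _ * _ = t * (t0 * g - x * w') + x * (w' * t)); last by ring.
by apply: (QD); apply: (QM).
Qed.

Lemma homog_ideal_gens I : homogeneous_ideal I -> exists gs,
  (forall g, g \in gs -> I g /\ exists d, g \is d.-homog) /\
  forall J, ideal J -> (forall g, g \in gs -> J g) -> forall f, I f -> J f.
Proof.
move=> [Iid Ic]; have [s [sI Hs]] := ideal_gens Iid.
exists [seq pihomog mdeg d x | x <- s, d <- iota 0 (msize x)]; split.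
  move=> _ /allpairsPdep[x [d [xs _ ->]]]; split; first by apply: Ic; apply: sI.
  by exists d; apply: pihomogP.
move=> J Jid JG; apply: Hs => // x xs; rewrite (comp_sum (leqnn (msize x))).
apply: ideal_sum => // i _; apply: JG; apply/allpairsPdep; exists x, (val i).
by rewrite mem_iota /= add0n.
Qed.

End Nakayama.

Section LocalGenerator.
Variable k : fieldType.
Notation S := {mpoly k[4]}.
Variables (p D B : S -> Prop) (y w : S) (o : nat).
Hypotheses (pp : prime_ideal p) (Did : ideal D) (Bid : ideal B) (yh : y \is 1.-homog).

(* Locally at [p], the classes [y ^ i * w] filter D / B as in a discrete valuation
   ring, so a form of least order generates. *)
Lemma local_generator :
  (forall e g, g \is e.-homog -> D g -> ~ B g -> exists d i s,
     [/\ (d + i + o)%N = e, s \is d.-homog, ~ p s & B (g - s * y ^+ i * w)]) ->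
exists e1 g1, [/\ g1 \is e1.-homog, D g1 & forall e g, g \is e.-homog -> D g ->
    exists n s c, [/\ s * g - c * g1 \is n.-homog, ~ p s & B (s * g - c * g1)]].
Proof.
move=> Hord; have [_ p1 ppr] := pp; have [B0 BD BM] := Bid.
case: (classic (exists i d s e g, [/\ (d + i + o)%N = e, g \is e.-homog, D g, s \is d.-homog &
    ~ p s /\ B (g - s * y ^+ i * w)])) => [|nex]; last first.
  exists 0%N, 0; split; [exact: dhomog0|by case: Did|] => e g gh Dg.
  have Bg : B g.
    apply: NNPP => nBg; have [d [i [s [E sh ps Bs]]]] := Hord e g gh Dg nBg.
    by apply: nex; exists i, d, s, e, g.
  by exists e, 1, 0; rewrite mul1r mul0r subr0.
move/least_nat => [i [[d1 [s1 [e1 [g1 [E1 g1h Dg1 s1h [ps1 Bs1]]]]]] imin]].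
exists e1, g1; split=> // e g gh Dg; case: (classic (B g)) => [Bg|nBg].
  by exists e, 1, 0; rewrite mul1r mul0r subr0.
have [d [j [s [E sh ps Bs]]]] := Hord e g gh Dg nBg.
have ij : (i <= j)%N.
  by rewrite leqNgt; apply/negP => /imin; apply; exists d, s, e, g.
exists (d1 + e)%N, s1, (s * y ^+ (j - i)); split=> //.
  apply: rpredB; first exact: dhomogM.
  have -> : (d1 + e = d + 1 * (j - i) + e1)%N by lia.
  by apply: dhomogM => //; apply: dhomogM => //; apply: dhomogMn.
rewrite (_ : _ - _ = s1 * (g - s * y ^+ j * w) - s * y ^+ (j - i) * (g1 - s1 * y ^+ i * w)).
  by apply: ideal_sub => //; apply: (BM).
have -> : y ^+ j = y ^+ (j - i) * y ^+ i by rewrite -exprD subnK.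
by ring.
Qed.

End LocalGenerator.

(** * Closed points of the plane and orders of vanishing *)

Section PlanePoints.
Variables (k : closedFieldType) (h : {mpoly k[4]}).
Notation S := {mpoly k[4]}.
Notation H := (principal h).
Hypotheses (h_linear : h \is 1.-homog) (h_neq0 : h != 0).

Let Hid : ideal H := principal_ideal h.
Let Hh : homogeneous_ideal H := principal_homog h_linear.
Let Hp : prime_ideal H := plane_prime h_linear h_neq0.

Lemma hilb_degree0 (J : S -> Prop) : ideal J -> ~ J 1 -> hilb J 0 = 1%N.
Proof.
move=> Jid J1; apply/eqP; rewrite eqn_leq; apply/andP; split; last first.
  exact: hilb_gt0 (dhomog1 _ _) J1.
have [Zid _] := zero_ideal_homog k; have := hilb_zero k 0; rewrite binn => <-.
by apply: hilb_le => // _ ->; case: Jid.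
Qed.

Lemma hilb_adj_linear (J : S -> Prop) u : homogeneous_ideal J -> u \is 1.-homog -> ~ J u ->
  hilb J 1 = (hilb (adj J u) 1).+1.
Proof.
move=> Jh uh nu; have [Jid _] := Jh; have := hilb_split 0 Jh uh.
rewrite !add0n (@hilb_degree0 (colon1 J u)) ?addn1 //; first exact: colon1_ideal.
by rewrite /colon1 mul1r.
Qed.

Lemma power_of_linear (L : S -> Prop) l n g : ideal L ->
  (forall i, exists a, L ('X_i - a *: l)) -> g \is n.-homog -> exists a, L (g - a *: l ^+ n).
Proof.
move=> Lid HX gh; have [L0 LD LM] := Lid.
have mono m : exists a, L ('X_[m] - a *: l ^+ mdeg m).
  move: {2}(mdeg m) (erefl (mdeg m)) => N; elim: N m => [|N IH] m mN.
    by exists 1; move/eqP: mN; rewrite mdeg_eq0 => /eqP->; rewrite mpolyX0 mdeg0 scale1r subrr.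
  have [i mi] : exists i, m i != 0%N.
    apply: NNPP => nex; suff E : m = 0%MM by rewrite E mdeg0 in mN.
    apply/mnmP => i; rewrite mnm0E; case: (eqVneq (m i) 0%N) => // mi.
    by case: nex; exists i.
  have im : (U_(i) <= m)%MM by rewrite lep1mP.
  have mE := submK im; have mN' : mdeg (m - U_(i)) = N.
    by move: mN; rewrite -{1}mE mdegD mdeg1 addn1 => -[].
  have [a Ha] := IH _ mN'; have [b Hb] := HX i; exists (a * b).
  rewrite -{1}mE mpolyXD mN exprS; rewrite mN' in Ha.
  rewrite (_ : _ - _ = 'X_i * ('X_[m - U_(i)] - a *: l ^+ N) + a *: l ^+ N * ('X_i - b *: l)).
    by apply: LD; apply: (LM).
  by rewrite -!mul_mpolyC mpolyCM; ring.
have /choice[a Ha] := mono; exists (\sum_(m <- msupp g) g@_m * a m).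
rewrite {1}(mpolyE g) scaler_suml -sumrB big_seq; apply: ideal_sum => // m mg.
rewrite -scalerA -scalerBr; apply: ideal_scale => //.
by have := Ha m; rewrite (dhomog_mf gh mg).
Qed.

(** Modulo [p] every linear form is a multiple of [l], so in degree 1 the Hilbert function drops
    from 3 on the plane to 1 at [p], which two linear forms account for. Modulo these every form is
    a scalar times a power of [l], and the scalar is 0 for forms in [p]. *)
Lemma point_linear_generators p l N : point p -> p h -> l \is 1.-homog -> ~ p l ->
  (forall g, g \is N.+1.-homog -> exists c, c \is N.-homog /\ p (g - c * l)) ->
  exists u v, [/\ u \is 1.-homog, v \is 1.-homog & p = adj (adj H u) v].
Proof.
move=> pp ph lh pl Hl; have [pid p1 ppr] := point_prime pp.
have lin := point_coordinates pp Hl.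
have Hpsub := principal_sub pid ph.
have p_deg1 : hilb p 1 = 1%N.
  apply/esym/hilb_uniq => //; exists (fun=> l); split=> // [c|g /lin[a Ha]].
    rewrite big_ord1 => pc i; rewrite ord1; apply/eqP/negPn/negP => c0; apply: pl.
    by rewrite -(scalerK c0 l); apply: ideal_scale.
  by exists (fun=> a); rewrite big_ord1.
have new (J : S -> Prop) : ideal J -> (forall g, J g -> p g) -> hilb J 1 <> 1%N ->
    exists u, [/\ u \is 1.-homog, p u & ~ J u].
  move=> Jid Jp ne; apply: NNPP => nex; apply: ne; apply: etrans p_deg1.
  apply: eq_hilb_deg => // u uh; split; first exact: Jp.
  by move=> pu; apply: NNPP => nJ; apply: nex; exists u.
have H1 : hilb H 1 = 3 by rewrite hilb_plane.
have [|u [uh pu nHu]] := new H Hid Hpsub; first by rewrite H1.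
have := hilb_adj_linear Hh uh nHu; rewrite H1 => -[Hu1].
have Uh := adj_homog Hh uh; have [Uid _] := Uh.
have Up g : adj H u g -> p g by apply: adj_sub.
have [|v [vh pv nUv]] := new _ Uid Up; first by rewrite -Hu1.
have := hilb_adj_linear Uh vh nUv; rewrite -Hu1 => -[Hv1].
have Vh := adj_homog Uh vh; have [Vid _] := Vh.
have Vp g : adj (adj H u) v g -> p g by apply: adj_sub.
exists u, v; split=> //; apply: predicate_ext => g; split; last exact: Vp.
have [pph _ _ _] := pp; move: g; apply: (homog_ideal_ext pph) => // n g gh pg.
have [|a Ha] := power_of_linear Vid _ gh (l := l).
  move=> i; have [a Ha] := lin _ (homogX k i); exists a.
  apply: (hilb_eq_sub Vid pid Vp (n := 1%N) _ _ Ha); first by rewrite -Hv1 p_deg1.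
  by apply: rpredB; [apply: homogX | apply: dhomogZ].
case: (eqVneq a 0) => [a0|a0]; first by move: Ha; rewrite a0 scale0r subr0.
case: pl; apply: (prime_expr (point_prime pp) (n := n)).
rewrite -(scalerK a0 (l ^+ n)); apply: ideal_scale => //.
by rewrite -(subKr g (a *: l ^+ n)); apply: ideal_sub => //; apply: Vp.
Qed.

(** Here [y] acts as a uniformizer at [p] on S / (h, x): as long as the form lies in [p], a factor
    [y] is extracted, and the degree bounds the process. *)
Lemma order_decomposition p x y e g : point p -> x \is 1.-homog -> y \is 1.-homog ->
  p = adj (adj H x) y -> g \is e.-homog -> ~ adj H x g ->
  exists d i s, [/\ (d + i)%N = e, s \is d.-homog, ~ p s & adj H x (g - s * y ^+ i)].
Proof.
move=> pp xh yh pE; have Bh := adj_homog Hh xh; have [Bid _] := Bh.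
elim: e g => [|e IH] g gh nBg.
  exists 0%N, 0%N, g; rewrite mulr1 subrr; split=> //; last by case: Bid.
  have [pid p1 _] := point_prime pp; apply: contra_not p1; apply: ideal_constant => //.
  by apply/eqP => g0; apply: nBg; rewrite g0; case: Bid.
case: (classic (p g)) => [pg|pg]; last first.
  by exists e.+1, 0%N, g; rewrite addn0 mulr1 subrr; split=> //; case: Bid.
rewrite pE in pg; have [_ [c [ch Bc]]] := adj_witness Bh yh gh pg nBg.
rewrite subn1 /= in ch.
have [|d [i [s [E sh ps Bs]]]] := IH c ch.
  by move=> Bc'; apply: nBg; apply: (ideal_subK Bid Bc); apply: ideal_mulr.
exists d, i.+1, s; split=> //; first by rewrite addnS E.
rewrite exprSr mulrA (_ : _ - _ = (g - c * y) + y * (c - s * y ^+ i)); last by ring.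
by have [_ BD BM] := Bid; apply: BD => //; apply: BM.
Qed.

End PlanePoints.

(** * The triple of a curve in the double plane *)

(** Each of finitely many homogeneous generators of the saturation is multiplied into [I] by all
    forms of large degree, so both ideals agree in large degrees. *)
Lemma hilb_saturation (k : fieldType) (I : {mpoly k[4]} -> Prop) : homogeneous_ideal I ->
  exists N, forall n, (N <= n)%N -> hilb (saturation I) n = hilb I n.
Proof.
move=> Ih; have [Iid Ic] := Ih; have sid := saturation_ideal Iid.
have [gs [gsI gsJ]] := homog_ideal_gens (saturation_homog Ih).
have [N HN] : exists N, forall g, g \in gs -> forall n a, (N <= n)%N -> I (pihomog mdeg n (a * g)).
  elim: gs gsI {gsJ} => [|g gs IH] gsI; first by exists 0%N.
  have [g' g'gs|N HN] := IH; first by apply: gsI; rewrite inE g'gs orbT.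
  have [|/(saturationP Iid)[M HM] [e gh]] := gsI g; first by rewrite inE eqxx.
  exists (maxn N (M + e)) => g'; rewrite inE => /orP[/eqP->|g'gs] n a;
    rewrite geq_max => /andP[Nn Mn].
    rewrite (compMr _ _ gh); case: ifP => _; last by case: Iid.
    by apply: (HM (n - e)%N); [lia | apply: pihomogP].
  exact: HN.
exists N => n Nn; apply: eq_hilb_deg => // g gh; split; last exact: saturationW.
move=> sg; rewrite -(pihomog_dE gh) -[g]mul1r.
pose J g := forall a, I (pihomog mdeg n (a * g)).
apply: (gsJ J _ _ _ sg 1) => [|x xgs a]; last exact: HN.
split=> [a|x y Jx Jy a|x y Jy a]; rewrite ?mulr0 ?raddf0; first by case: Iid.
  by rewrite mulrDr raddfD; have [_ ID _] := Iid; apply: ID; [apply: Jx | apply: Jy].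
by rewrite mulrA; apply: Jy.
Qed.

Section Triple.
Variables (k : closedFieldType) (h : {mpoly k[4]}).
Notation S := {mpoly k[4]}.
Notation H := (principal h).
Hypotheses (h_linear : h \is 1.-homog) (h_neq0 : h != 0).

Let Hid : ideal H := principal_ideal h.
Let Hh : homogeneous_ideal H := principal_homog h_linear.
Let Hp : prime_ideal H := plane_prime h_linear h_neq0.

Variables (C Z : S -> Prop) (d : nat) (f : S).
Hypotheses (C_curve : curve C) (C_sub_2H : subscheme C (principal (h ^+ 2))).
Hypotheses (Z_zero_dim : zero_dimensional Z) (Z_sub_H : subscheme Z H).
Hypotheses (f_homog : f \is d.-homog) (f_notin : ~ H f) (P_curve : curve (adj H f)).
Hypothesis C_cap_H : same_scheme (scheme_cap C H)
  (saturation (ideal_add (ideal_mul Z (adj H f)) H)).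

Let Ch : homogeneous_ideal C. Proof. by case: C_curve => -[]. Qed.
Let Cid : ideal C. Proof. by case: Ch. Qed.
Let Zid : ideal Z. Proof. by case: Z_zero_dim => -[[]]. Qed.
Let Zh : homogeneous_ideal Z. Proof. by case: Z_zero_dim => -[]. Qed.

Lemma C_hh : C (h * h).
Proof. by apply: C_sub_2H; exists 1; rewrite mul1r expr2. Qed.

Lemma generic_h q : generic_point C q -> q h.
Proof.
by move=> [[[_ _ qp _] Cq] _]; have [] := qp h h (Cq _ C_hh).
Qed.

(** A component of C is one-dimensional; if Z contained it, its chain of points would be a chain in
    Z. *)
Lemma generic_Z q : generic_point C q -> exists z, Z z /\ ~ q z.
Proof.
move=> qC; apply: NNPP => nex; have [_ nZ] := Z_zero_dim; apply: nZ.
have [_ _ /(_ q qC) [qch _] _] := C_curve; apply: has_chain_sub qch => z Zz.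
by apply: NNPP => nqz; apply: nex; exists z.
Qed.

Lemma cancel_f a b : H (a * f - b * f) -> H (a - b).
Proof. by rewrite -mulrBl; have [_ _ pr] := Hp => /pr[]. Qed.

(** No saturation remains on the right: as P is saturated an element is [c * f] modulo [h], and as
    [f] cancels modulo [h] and Z is saturated, [c] lies in Z. *)
Lemma cap_plane : saturation (adj C h) = fun g => exists z, Z z /\ H (g - z * f).
Proof.
apply: predicate_ext => g.
have [_ HD HM] := Hid; have [Z0 ZD ZM] := Zid.
have HZ c : H c -> Z c by exact: Z_sub_H.
have adjE u : ideal_add C H u <-> adj C h u.
  split=> [[a [_ [Ca [c ->] ->]]]|[c Hc]]; first by exists c; rewrite addrK.
  by exists (u - c * h), (c * h); rewrite subrK; split=> //; exists c.
have mulE u : ideal_add (ideal_mul Z (adj H f)) H u <-> exists z, Z z /\ H (u - z * f).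
  split=> [[_ [b [[s [sP ->]] Hb ->]]]|[z [Zz [c uE]]]].
    elim: s sP => [|[x1 x2] s IH] sP.
      by exists 0; rewrite big_nil mul0r subr0 add0r.
    have [x xs|z [Zz Hz]] := IH; first by apply: sP; rewrite inE xs orbT.
    have [|/= Zx1 [c Hc]] := sP (x1, x2); first by rewrite inE eqxx.
    exists (z + x1 * c); split; first by apply: ZD => //; apply: ideal_mulr.
    rewrite big_cons /= (_ : _ - _ = (\sum_(x <- s) x.1 * x.2 + b - z * f) + x1 * (x2 - c * f)).
      by apply: HD => //; apply: HM.
    by ring.
  exists (z * f), (u - z * f); split; [|by exists c|by rewrite addrC subrK].
  exists [:: (z, f)]; rewrite big_seq1; split=> // x; rewrite inE => /eqP-> /=.
  by split=> //; apply: adj_gen.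
have [sat1 sat2] := C_cap_H g; split=> [[N HN]|[z Hz]].
  have [|M HM'] := sat1; first by exists N => m mN; apply/adjE; apply: HN.
  have [[Ph Psat] _ _ _] := P_curve; have [Pid _] := Ph.
  have [|c Hc] := Psat g.
    exists M => m /HM'/mulE[z [_ Hz]]; by exists z.
  exists c; split=> //; have [[_ Zsat] _] := Z_zero_dim; apply: Zsat.
  exists M => m /HM'/mulE[z [Zz Hz]].
  apply: (ideal_subK Zid _ Zz); apply: HZ; apply: cancel_f.
  rewrite (_ : _ - _ = ('X_[m] * g - z * f) - 'X_[m] * (g - c * f)); last by ring.
  by apply: ideal_sub => //; apply: HM.
have [|N HN] := sat2; last by exists N => m mN; apply/adjE; apply: HN.
exists 0%N => m /eqP; rewrite mdeg_eq0 => /eqP->; rewrite mpolyX0 mul1r.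
by apply/mulE; exists z.
Qed.

(** A power of a variable outside [p] absorbs the saturation in [cap_plane]. *)
Lemma local_lift p z : point p -> Z z ->
  exists s c, ~ p s /\ C (s * (z * f) - c * h).
Proof.
move=> pp Zz; have [_ _ _ [i pi]] := pp.
have : saturation (adj C h) (z * f).
  by rewrite cap_plane; exists z; rewrite subrr; split=> //; case: Hid.
move/(saturationP (adj_ideal h Cid)) => [N HN].
have [|c Hc] := HN (1 * N)%N ('X_i ^+ N) _ (dhomogMn N (homogX k i)); first by rewrite mul1n.
exists ('X_i ^+ N), c; split=> //; exact: contra_not (prime_expr (point_prime pp)) pi.
Qed.

Lemma local_lift_generic q : generic_point C q ->
  exists s c, ~ q s /\ C (s * f - c * h).
Proof.
move=> qC; have [[pp _] _] := qC; have [z [Zz qz]] := generic_Z qC.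
have [s [c [qs Hs]]] := local_lift pp Zz; exists (s * z), c; rewrite -mulrA; split=> //.
by have [_ _ pr _] := pp => /pr[].
Qed.

Let Yr := colon1 C h.
Let Yid : ideal Yr := colon1_ideal h Cid.
Let Yh : homogeneous_ideal Yr := colon1_homog Ch h_linear.

Lemma P_sub_Y : forall g, adj H f g -> Yr g.
Proof.
have [_ CD CM] := Cid.
have Yhh : Yr h := C_hh.
apply: adj_sub => //; first by apply: principal_sub.
apply: (in_curve C_curve (dhomogM f_homog h_linear)) => q qC.
have [s [c [qs Hs]]] := local_lift_generic qC; exists s; split=> //.
rewrite (_ : s * _ = h * (s * f - c * h) + c * (h * h)); last by ring.
by apply: (CD); apply: (CM) => //; apply: C_hh.
Qed.

Lemma Y_sub_Z : forall g, Yr g -> Z g.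
Proof.
have [_ CD CM] := Cid; apply: (homog_ideal_ext Yh) => // e g gh Yg.
have Cgf : C (g * f).
  apply: (in_curve C_curve (dhomogM gh f_homog)) => q qC.
  have [s [c [qs Hs]]] := local_lift_generic qC; exists s; split=> //.
  rewrite (_ : s * _ = g * (s * f - c * h) + c * (g * h)); last by ring.
  by apply: (CD); apply: (CM).
have : saturation (adj C h) (g * f).
  by apply: saturationW; [apply: adj_ideal | apply: adjW].
rewrite cap_plane => -[z [Zz /cancel_f Hgz]].
by apply: (ideal_subK Zid _ Zz); apply: Z_sub_H.
Qed.

(** Multiplication by [h] embeds S / (C : h), up to a shift, into S / C. *)
Lemma associated_Y p : associated_point Yr p -> associated_point C p.
Proof.
by move=> [pp [g pg]]; split=> //; exists (g * h) => a; rewrite pg /Yr /colon1 mulrA.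
Qed.

(** The empty Y is included: then [y = 0] and [e] is a non-zero constant. *)
Lemma Y_principal : exists y e, [/\ e \is y.-homog, ~ H e & Yr = adj H e].
Proof.
have [[_ Csat] _ Cgen Cass] := C_curve.
have [||p /associated_Y/Cass/Cgen[]//|y [e [eh ne YE]]] :=
  plane_curve_principal h_linear h_neq0 Yh (colon1_saturated Csat).
- exact: C_hh.
- by exists f; split=> //; apply: P_sub_Y; apply: adj_gen.
by exists y, e; split=> //; apply: predicate_ext.
Qed.

(** A component of Y is cut out by a prime factor [pi] of the equation [e], hence is the annihilator
    of the cofactor [e'] modulo Y. It is therefore associated to Y, then to C, and inherits
    dimension one. *)
Lemma Y_curve : ~ C h -> curve Yr.
Proof.
move=> nCh; have [[_ Csat] _ Cgen Cass] := C_curve.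
split=> [||q [[qp Yq] qmin]|p pass].
- by split=> //; apply: colon1_saturated.
- by rewrite /empty_scheme /Yr /colon1 mul1r.
- have [y [e [eh ne YE]]] := Y_principal.
  have qh : q h by apply: Yq; apply: C_hh.
  have qe : q e by apply: Yq; rewrite YE; apply: adj_gen.
  have [m [pi [pih qpi npi Kp [e' Ke']]]] :=
    plane_homog_prime_factor h_linear h_neq0 eh ne (point_prime qp) qh qe.
  have [qid _ _] := point_prime qp; have Kh := adj_homog Hh pih.
  have Kq g : adj H pi g -> q g by apply: adj_sub => //; apply: principal_sub.
  have [Kid K1 Kpr] := Kp.
  have YK g : Yr g -> adj H pi g.
    rewrite YE; apply: adj_sub => //; first by move=> a; apply: adjW.
    by exists e'.
  have qK g : q g <-> adj H pi g.
    split; last exact: Kq.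
    apply: (qmin (adj H pi)) => //; split=> //; split=> //.
    by have [_ _ _ [i qi]] := qp; exists i => /Kq.
  have [_ _ Hpr] := Hp; have [_ HD HM] := Hid.
  have ne' : ~ H e'.
    by move=> He'; apply: ne; apply: (ideal_subK Hid Ke'); apply: ideal_mulr.
  apply: Cgen; apply: Cass; apply: associated_Y; split=> //; exists e' => g.
  rewrite qK YE; split=> [[c Hc]|[c Hc]]; exists c.
    rewrite (_ : _ - _ = e' * (g - c * pi) - c * (e - e' * pi)); last by ring.
    by apply: ideal_sub => //; apply: (HM).
  have /Hpr[//|] : H ((g - c * pi) * e').
    rewrite (_ : _ * _ = (g * e' - c * e) + c * (e - e' * pi)); last by ring.
    by apply: (HD) => //; apply: (HM).
  by [].
- have pC := Cass _ (associated_Y pass).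
  have [pp [g pg]] := pass; split.
    by split=> // a Ya; apply/pg; apply: ideal_mulr.
  move=> q [qp Yq]; have [_ pmin] := pC; apply: pmin; split=> // a Ca.
  by apply: Yq; apply: ideal_mulr.
Qed.

(** If almost no choice of [x = u + t *: v] worked, a generic point of C would contain [u], [v] and
    [h], hence [p] and Z, against the dimension of Z. Replacing [u] by [x] does not change the ideal
    [p]. *)
Lemma pencil_nonzerodivisor p u v : point_of Z p ->
  u \is 1.-homog -> v \is 1.-homog -> p = adj (adj H u) v ->
  exists x, [/\ x \is 1.-homog, p = adj (adj H x) v &
    forall n g, g \is n.-homog -> C (x * g) -> C g].
Proof.
move=> [pp Zp] uh vh pE; have [[_ Csat] _ Cgen Cass] := C_curve.
pose l t : S := \sum_(i < 2) t ^+ i *: (if i == 0%N :> nat then u else v).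
have lE t : l t = u + t *: v by rewrite /l big_ord_recl big_ord1 /= expr0 scale1r expr1.
have [|t nt] := @closed_field_avoid k (fun t => exists q, generic_point C q /\ q (l t)).
  move=> inf; have [||q [qC qinf]] := infinite_incidence Ch _ _ inf.
  - by move=> q [].
  - by move=> q r [_ qmin] /qmin.
  have [[qp Cq] _] := qC; have [qid _ _] := point_prime qp.
  have quv := moment_curve qid qinf.
  have qu : q u := quv ord0.
  have qv : q v := quv ord_max.
  have qH := principal_sub qid (generic_h qC).
  have pq g : p g -> q g by rewrite pE; do 2!apply: adj_sub => //.
  have [_ nZ] := Z_zero_dim; apply: nZ.
  by have [qch _] := Cgen q qC; apply: has_chain_sub qch => g /Zp/pq.
exists (l t); split.
- by rewrite lE; apply: rpredD => //; apply: dhomogZ.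
- rewrite pE lE -mul_mpolyC; apply: predicate_ext => g.
  split=> -[c [b Hb]].
    exists (c - b * t%:MP), b.
    by rewrite (_ : _ - _ = g - c * v - b * u) //; ring.
  exists (c + b * t%:MP), b.
  by rewrite (_ : _ - _ = g - c * v - b * (u + t%:MP * v)) //; ring.
- move=> n g gh; apply: nonzerodivisor gh => // q /Cass qC qt.
  by apply: nt; exists q.
Qed.

(* Near [p], the ideal of C is generated modulo [h ^+ 2] by two elements: modulo the
   nonzerodivisor [x] it becomes a submodule of a free module of rank 2 over a
   discrete valuation ring. *)
Lemma curve_local_generators p x y : point_of Z p -> x \is 1.-homog -> y \is 1.-homog ->
  p = adj (adj H x) y -> (forall n g, g \is n.-homog -> C (x * g) -> C g) ->
  exists e1 g1 e2 g2 t, [/\ g1 \is e1.-homog, g2 \is e2.-homog, C g1, C g2 &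
    ~ p t /\ forall g, C g -> adj (adj (principal (h * h)) g1) g2 (t * g)].
Proof.
move=> [pp Zp] xh yh pE xC; have Bh := adj_homog Hh xh; have [Bid _] := Bh.
have pprime := point_prime pp; have [pid p1 ppr] := pprime.
have hhh : h * h \is 2.-homog := dhomogM h_linear h_linear.
have B2h := adj_homog (principal_homog hhh) xh; have [B2id _] := B2h.
(* The image of C in S / (h, x), filtered by the powers of [y], gives the first generator. *)
have [e1 [g1 [g1h Cg1 Hg1]]] : exists e1 g1, [/\ g1 \is e1.-homog, C g1 &
    forall e g, g \is e.-homog -> C g ->
    exists n s c, [/\ s * g - c * g1 \is n.-homog, ~ p s & adj H x (s * g - c * g1)]].
  apply: (local_generator pprime Cid Bid yh (w := 1) (o := 0)) => e g gh Cg nBg.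
  have [d' [i [s [E sh ps Bs]]]] := order_decomposition h_linear pp xh yh pE gh nBg.
  by exists d', i, s; rewrite addn0 mulr1.
(* The elements of C vanishing in S / (h, x). Modulo (h * h, x) they are multiples of [h], which is
   the second copy of the valuation ring; hence [w := h], of degree [o := 1]. *)
pose D g := C g /\ adj H x g.
have Did : ideal D.
  have [C0 CD CM] := Cid; have [B0 BD BM] := Bid.
  by split=> // [a b [? ?] [? ?]|a b [? ?]]; split; auto.
have hB a : adj H x a -> adj (principal (h * h)) x (a * h).
  move=> [b [c E]]; exists (b * h), c.
  rewrite (_ : _ - _ = (a - b * x) * h); last by ring.
  by rewrite E mulrA.
have [e2 [g2 [g2h [Cg2 Bg2] Hg2]]] : exists e2 g2, [/\ g2 \is e2.-homog, D g2 &
    forall e g, g \is e.-homog -> D g -> exists n s c,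
    [/\ s * g - c * g2 \is n.-homog, ~ p s & adj (principal (h * h)) x (s * g - c * g2)]].
  apply: (local_generator pprime Did B2id yh (w := h) (o := 1)) => e g gh [Cg [b0 [c0 E0]]] nB2.
  have xprin := principal_homog xh; have [xid _] := xprin.
  have gadj : adj (principal x) h g by exists c0, b0; rewrite -E0; ring.
  have ngx : ~ principal x g.
    by move=> [b gE]; apply: nB2; exists b; rewrite gE subrr; case: (principal_ideal (h * h)).
  have [e_gt0 [c [ch [b Eb]]]] := adj_witness xprin h_linear gh gadj ngx.
  have nBc : ~ adj H x c.
    move=> Bc; apply: nB2; apply: (ideal_subK B2id _ (hB c Bc)).
    by rewrite Eb; exists b; rewrite subrr; case: (principal_ideal (h * h)).
  have [d' [i [s [E sh ps Bs]]]] := order_decomposition h_linear pp xh yh pE ch nBc.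
  exists d', i, s; split=> //; first by rewrite E subnK.
  rewrite (_ : _ - _ = (g - c * h) + (c - s * y ^+ i) * h); last by ring.
  have [_ B2D _] := B2id; apply: B2D; last exact: hB.
  by rewrite Eb; exists b; rewrite subrr; case: (principal_ideal (h * h)).
have [gs [gsC gsJ]] := homog_ideal_gens Ch.
pose Q := adj (adj (principal (h * h)) g1) g2.
have Q0id := principal_ideal (h * h); have Q1id := adj_ideal g1 Q0id.
have Qid : ideal Q := adj_ideal g2 Q1id.
have Chh := C_hh.
have px : p x by rewrite pE; apply: adjW => //; apply: adj_gen.
have [g ggs|t [pt Ht]] := @local_nakayama _ p x Q gs pprime px Qid.
  have [Cg [e gh]] := gsC g ggs; have [_ CD CM] := Cid.
  have [n1 [s1 [c1 [h1 ps1 B1]]]] := Hg1 e g gh Cg.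
  have Cd1 : C (s1 * g - c1 * g1) by apply: ideal_sub => //; apply: (CM).
  have [n2 [s2 [c2 [h2 ps2 B2]]]] := Hg2 n1 _ h1 (conj Cd1 B1).
  have Cd2 : C (s2 * (s1 * g - c1 * g1) - c2 * g2) by apply: ideal_sub => //; apply: (CM).
  set r := s2 * _ - _ in h2 B2 Cd2.
  (* After subtracting multiples of [g1] and [g2], what remains is [w * x] modulo [h * h]. As [x] is
     a nonzerodivisor modulo C, [w] is itself in C, as Nakayama requires. *)
  have [w [m [wh [b Eb]]]] : exists w m, w \is m.-homog /\ principal (h * h) (r - w * x).
    case: (classic (principal (h * h) r)) => [Pr|nPr].
      by exists 0, 0%N; rewrite mul0r subr0; split=> //; apply: dhomog0.
    have [_ [w [wh Pw]]] := adj_witness (principal_homog hhh) xh h2 B2 nPr.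
    by exists w, (n2 - 1)%N.
  have Cw : C w.
    apply: (xC m) => //; rewrite mulrC -(subKr r (w * x)) Eb.
    by apply: ideal_sub => //; apply: (CM).
  exists (s2 * s1), w; split; first by move/ppr => [].
    by apply: (gsJ _ (span_ideal_ideal gs) _ _ Cw); apply: span_ideal_gen.
  exists c2, (s2 * c1), b; rewrite -Eb /r; ring.
exists e1, g1, e2, g2, t; split=> //; split=> // g Cg.
suff : colon1 Q t g by rewrite /colon1 mulrC.
apply: (gsJ _ (colon1_ideal t Qid) _ _ Cg) => a /Ht.
by rewrite /colon1 mulrC.
Qed.

Lemma cap_lift e g : g \is e.-homog -> C g ->
  exists m a, [/\ a \is m.-homog, Z a & H (g - a * f)].
Proof.
move=> gh Cg; have : saturation (adj C h) g.
  by apply: saturationW; [apply: adj_ideal | apply: adjW].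
rewrite cap_plane => -[a [Za Ha]]; have [_ Hc] := Hh; have [_ Zc] := Zh.
have := Hc _ e Ha; rewrite raddfB /= (pihomog_dE gh) (compMr _ _ f_homog).
case: ifP => _ H'; last by exists 0%N, 0; rewrite mul0r; split=> //; [apply: dhomog0|case: Zid].
by exists (e - d)%N, (pihomog mdeg (e - d) a); split=> //; [apply: pihomogP|apply: Zc].
Qed.

Lemma Z_lci : lci_in_plane h Z.
Proof.
move=> p pZ; have [pp Zp] := pZ; have [pid p1 ppr] := point_prime pp.
have [[_ Zsat] _] := Z_zero_dim.
have [l [lh l_off]] := linear_form_off Z_zero_dim.
have pl := l_off p pZ.
have ph : p h by apply: Zp; apply: Z_sub_H; exists 1; rewrite mul1r.
have [N HN] := off_surjective Zh lh l_off.
have [|u [v [uh vh pE]]] := point_linear_generators h_linear h_neq0 (N := N) pp ph lh pl.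
  move=> g gh; have Hg := HN _ g (leqnSn N) gh.
  case: (classic (Z g)) => [Zg|nZg].
    by exists 0; rewrite mul0r subr0; split; [apply: dhomog0 | apply: Zp].
  have [_ [c [ch Zc]]] := adj_witness Zh lh gh Hg nZg.
  by exists c; rewrite subn1 in ch; split=> //; apply: Zp.
have [x [xh pE' xC]] := pencil_nonzerodivisor pZ uh vh pE.
have [e1 [g1 [e2 [g2 [t [g1h g2h Cg1 Cg2 [pt Ht]]]]]]] := curve_local_generators pZ xh vh pE' xC.
have [m1 [a1 [a1h Za1 Ha1]]] := cap_lift g1h Cg1.
have [m2 [a2 [a2h Za2 Ha2]]] := cap_lift g2h Cg2.
exists m1, m2, a1, a2; split=> //.
pose L := adj (adj H a1) a2; have Lh : homogeneous_ideal L := adj_homog (adj_homog Hh a1h) a2h.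
have [Lid Lc] := Lh; have [_ HD HM] := Hid; have [_ _ LM] := Lid.
have local z : Z z -> exists s, ~ p s /\ L (s * z).
  move=> Zz; have [s [c [ps Cs]]] := local_lift pp Zz.
  have [c2 [c1 [b E]]] := Ht _ Cs.
  exists (t * s); split; first by move/ppr => [].
  exists c2, c1; rewrite -addrA -opprD.
  (* The lift of [z * f] to C is a combination of [g1], [g2] and [h * h]; modulo [h] these become
     [a1 * f], [a2 * f] and 0. *)
  apply: cancel_f.
  rewrite (_ : _ - _ = b * (h * h) + t * c * h + c2 * (g2 - a2 * f) + c1 * (g1 - a1 * f)).
    apply: (HD); last exact: (HM).
    apply: (HD); last exact: (HM).
    apply: (HD); first by exists (b * h); rewrite mulrA.
    by exists (t * c).
  by rewrite -E; ring.
have homog_local e z : z \is e.-homog -> Z z -> exists r s, [/\ s \is r.-homog, ~ p s & L (s * z)].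
  move=> zh /local[s [ps Ls]]; have [r pr] := notin_comp pid ps.
  exists r, (pihomog mdeg r s); split=> //; first exact: pihomogP.
  by have := Lc _ (r + e)%N Ls; rewrite (compMr _ _ zh) leq_addl addnK.
move=> z Zz; have [_ Zc] := Zh.
(* The multiplier must be a form, which [homog_local] gives for one component of [z] at a time; the
   product over all components serves for [z]. *)
have [r [s [sh ps Ls]]] : exists r s, [/\ s \is r.-homog, ~ p s &
    forall i, (i < msize z)%N -> L (s * pihomog mdeg i z)].
  elim: (msize z) => [|n [r [s [sh ps Ls]]]].
    by exists 0%N, 1; split=> //; apply: dhomog1.
  have [r' [s' [sh' ps' Ls']]] := homog_local n _ (pihomogP _ _ _) (Zc _ n Zz).
  exists (r + r')%N, (s * s'); split; [exact: dhomogM|by move/ppr => []|].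
  move=> i; rewrite ltnS leq_eqVlt => /orP[/eqP->|/Ls Li]; first by rewrite -mulrA; apply: (LM).
  by rewrite [s * s']mulrC -mulrA; apply: (LM).
have [c2 [c1 [b E]]] : L (s * z).
  rewrite (comp_sum (leqnn (msize z))) mulr_sumr; apply: ideal_sum => // i _.
  exact: Ls.
by exists r, s, c1, c2, b; split=> //; rewrite -E; ring.
Qed.

Lemma hilb_curve : exists N, forall n, (N <= n)%N ->
  hilb C n.+1 = (hilb (adj H f) n.+1 + scheme_length Z + hilb Yr n)%N.
Proof.
have [N1 HN1] := scheme_length_hilb Z_zero_dim.
have [N2 HN2] := hilb_saturation (adj_homog Ch h_linear).
exists (N1 + N2 + d)%N => n Nn.
rewrite -addn1 (hilb_split n Ch h_linear) addn1; congr (_ + _)%N.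
rewrite -HN2; last by lia.
have satid := saturation_homog (adj_homog Ch h_linear).
have := hilb_split (n.+1 - d) satid f_homog; rewrite subnK; last by lia.
(* By [cap_plane], adding [f] to the saturation gives the ideal of P, and its colon by [f] is the
   ideal of Z. *)
move=> ->; have [sid _] := satid; congr (_ + _)%N.
  apply: eq_hilb => [||g]; [exact: adj_ideal|exact: adj_ideal|].
  rewrite cap_plane; have [_ HD HM] := Hid; have [Z0 _ _] := Zid.
  split=> [[c [z [_ Hz]]]|[c Hc]]; last by exists c, 0; rewrite mul0r subr0.
  by exists (c + z); rewrite mulrDl opprD addrA.
rewrite -(HN1 (n.+1 - d)%N); last by lia.
apply: eq_hilb => [|//|g]; first exact: colon1_ideal.
rewrite cap_plane /colon1; split=> [[z [Zz /cancel_f Hz]]|Zg].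
  by apply: (ideal_subK Zid _ Zz); apply: Z_sub_H.
by exists g; rewrite subrr; split=> //; case: Hid.
Qed.

End Triple.

(** * Hilbert polynomials *)

Lemma poly_eq_large (p q : {poly rat}) N :
  (forall n : nat, (N <= n)%N -> p.[n%:R] = q.[n%:R]) -> p = q.
Proof.
move=> pq; apply/eqP; rewrite -subr_eq0; apply/negPn/negP => r0.
pose s : seq rat := [seq n%:R | n <- iota N (size (p - q))].
have /(max_poly_roots r0) : all (root (p - q)) s.
  apply/allP => _ /mapP[n + ->]; rewrite mem_iota => /andP[Nn _].
  by rewrite rootE hornerD hornerN pq // subrr.
rewrite size_map size_iota ltnn => H; apply: notF; apply: H.
by rewrite map_inj_uniq ?iota_uniq // => m n /eqP; rewrite eqr_nat => /eqP.
Qed.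

Section HilbertPolynomial.
Variable k : fieldType.
Implicit Types X : {mpoly k[4]} -> Prop.

(** The choice made by [epsilon] is harmless, as polynomials agreeing at all large integers
    coincide. *)
Lemma hilbert_polyE X (Q : {poly rat}) N : ideal X ->
  (forall n, (N <= n)%N -> Q.[n%:R] = (hilb X n)%:R) -> hilbert_poly X = Q.
Proof.
move=> Xid HQ; have : is_hilbert_poly X (hilbert_poly X).
  rewrite /hilbert_poly; apply: epsilon_spec; exists Q, N => n Nn.
  by exists (hilb X n); split; [apply: hilbP | apply: HQ].
move=> [M HM]; apply: (@poly_eq_large _ _ (M + N)) => n MNn.
have [|m [mX ->]] := HM n; first by apply: leq_trans MNn; apply: leq_addr.
rewrite (hilb_uniq Xid mX) HQ //; apply: leq_trans MNn; exact: leq_addl.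
Qed.

(** The side condition serves the empty scheme: its polynomial must be 0, since a non-zero constant
    would have a non-zero leading coefficient. *)
Lemma degree_linear X c (b : rat) : hilbert_poly X = c%:R *: 'X + b%:P ->
  (c = 0%N -> b = 0) -> degree X = c%:R.
Proof.
move=> XE cb; rewrite /degree XE; case: c cb {XE} => [|c] cb.
  by rewrite cb // scale0r add0r lead_coef0 mulr0.
have c0 : (c.+1)%:R != 0 :> rat by rewrite pnatr_eq0.
have sX : size (c.+1%:R *: 'X : {poly rat}) = 2%N by rewrite size_scale // size_polyX.
have sb : (size (b%:P) < size (c.+1%:R *: 'X : {poly rat}))%N.
  by rewrite sX ltnS size_polyC leq_b1.
rewrite size_polyDl // sX lead_coefDl // lead_coefZ lead_coefX mulr1.
by rewrite /= mul1r.
Qed.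

End HilbertPolynomial.

(** This is 1 minus the genus (d - 1)(d - 2)/2 of a plane curve of degree [d], and it vanishes for
    [d = 0], as the empty Y requires. *)
Definition plane_curve_constant (d : nat) : rat := d%:R * (3%:R - d%:R) / 2%:R.

Lemma hilb_plane_curve_rat (k : fieldType) (h f : {mpoly k[4]}) d n :
  h \is 1.-homog -> h != 0 -> f \is d.-homog -> ~ principal h f -> (d <= n)%N ->
  (hilb (adj (principal h) f) n)%:R = d%:R * n%:R + plane_curve_constant d.
Proof.
move=> hh h0 fh nf dn; have := hilb_plane_curve hh h0 (n - d) fh nf.
rewrite subnK // => E.
have bin2R m : ('C(m + 2, 2))%:R = (m%:R + 2%:R) * (m%:R + 1) / 2%:R :> rat.
  by rewrite -natrD -[1]/(1%:R) -natrD -natrM -bin_double natrM mulfK // pnatr_eq0.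
have := congr1 (fun m : nat => m%:R : rat) E; rewrite natrD !bin2R natrB // => {}E.
have -> : (hilb (adj (principal h) f) n)%:R = (n%:R + 2%:R) * (n%:R + 1) / 2%:R -
    (n%:R - d%:R + 2%:R) * (n%:R - d%:R + 1) / 2%:R :> rat by rewrite -E addrK.
by rewrite /plane_curve_constant; field.
Qed.

Theorem proposition2p1 (k : closedFieldType) (h : {mpoly k[4]})
    (C Z Y P : {mpoly k[4]} -> Prop)
    (h_linear : h \is 1.-homog) (h_neq0 : h != 0)
    (C_curve : curve C) (C_sub_2H : subscheme C (principal (h ^+ 2)))
    (C_triple : associated_triple h C Z Y P) :
  [/\ subscheme Z Y, subscheme Y P & subscheme P (principal h)] /\
  (zero_dimensional Z /\ lci_in_plane h Z) /\
  [/\ subscheme C (principal h) -> empty_scheme Y,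
      ~ subscheme C (principal h) -> curve Y & curve P] /\
  degree C = degree Y + degree P /\
  curve_genus C =
    (degree Y - 1) * (degree Y - 2%:R) / 2%:R
    + (degree P - 1) * (degree P - 2%:R) / 2%:R
    + degree Y - (scheme_length Z)%:R - 1.
Proof.
have [[P_curve P_sub_H] [Z_zero_dim Z_sub_H] C_cap_H Y_colon] := C_triple.
have [d [f [d_gt0 fh nf PE]]] := plane_curve_ideal h_linear h_neq0 P_curve P_sub_H.
have {Y_colon} YE : Y = colon1 C h.
  apply: predicate_ext => g; rewrite Y_colon; split=> [H|Cgh].
    by apply: H; exists 1; rewrite mul1r.
  move=> _ [c ->]; rewrite mulrCA; have [[[[_ _ CM] _] _] _ _ _] := C_curve.
  exact: CM.
rewrite PE in P_curve P_sub_H C_cap_H; rewrite {}YE {P C_triple}PE.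
have [[[Cid _] _] _ _ _] := C_curve.
have Ch_iff : subscheme C (principal h) <-> C h.
  split=> [|Ch g [c ->]]; first by apply; exists 1; rewrite mul1r.
  by have [_ _ CM] := Cid; apply: CM.
have [y [e [eh ne YE]]] := Y_principal h_linear h_neq0 C_curve C_sub_2H Z_zero_dim
  Z_sub_H fh nf P_curve C_cap_H.
have [N HN] := hilb_curve h_linear h_neq0 C_curve Z_zero_dim Z_sub_H fh nf P_curve C_cap_H.
split; [|split; [|split; [|]]].
- split=> //.
  + exact: (Y_sub_Z h_linear h_neq0 C_curve Z_zero_dim Z_sub_H fh nf P_curve C_cap_H).
  + exact: (P_sub_Y h_linear h_neq0 C_curve C_sub_2H Z_zero_dim Z_sub_H fh nf P_curve C_cap_H).
- split=> //.
  exact: (Z_lci h_linear h_neq0 C_curve C_sub_2H Z_zero_dim Z_sub_H fh nf P_curve C_cap_H).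
- split=> //.
    by move/Ch_iff => Ch; rewrite /empty_scheme /colon1 mul1r.
  move=> nCh; apply: (Y_curve h_linear h_neq0 C_curve C_sub_2H Z_zero_dim
    Z_sub_H fh nf P_curve C_cap_H).
  by move/Ch_iff.
have planeE m (g : {mpoly k[4]}) : g \is m.-homog -> ~ principal h g ->
    hilbert_poly (adj (principal h) g) = m%:R *: 'X + (plane_curve_constant m)%:P.
  move=> gh ng; apply: (hilbert_polyE (N := m)); first exact/adj_ideal/principal_ideal.
  move=> n mn; rewrite (hilb_plane_curve_rat h_linear h_neq0 gh ng mn).
  by rewrite hornerD hornerZ hornerX hornerC.
have planeD m (g : {mpoly k[4]}) : g \is m.-homog -> ~ principal h g ->
    degree (adj (principal h) g) = m%:R.
  move=> gh ng; apply: (degree_linear (planeE m g gh ng)) => ->.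
  by rewrite /plane_curve_constant !mul0r.
(* The term [- y%:R] comes from the shift by one: Y is evaluated in degree [n] where C is evaluated
   in degree [n.+1]. *)
have CE : hilbert_poly C = (y + d)%N%:R *: 'X + (plane_curve_constant d + plane_curve_constant y
    + (scheme_length Z)%:R - y%:R)%:P.
  apply: (hilbert_polyE (N := (N + y + d).+1)) => // -[//|n]; rewrite ltnS => Nn.
  rewrite HN; last by lia.
  rewrite YE !natrD (hilb_plane_curve_rat h_linear h_neq0 fh nf); last by lia.
  rewrite (hilb_plane_curve_rat h_linear h_neq0 eh ne); last by lia.
  by rewrite hornerD hornerZ hornerX hornerC -natr1; ring.
rewrite YE (planeD _ _ fh nf) (planeD _ _ eh ne); split.
  rewrite (degree_linear CE) ?natrD // => /eqP; rewrite addn_eq0 => /andP[_ /eqP d0].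
  by rewrite d0 in d_gt0.
rewrite /curve_genus CE hornerD hornerZ hornerX hornerC mulr0 add0r /plane_curve_constant.
by field.
Qed.
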